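(* Let $\mathcal{R}$ be $\mathcal{G}$, $\mathcal{E}$ or $\mathcal{H}$. Suppose $\Lambda$ is a positive-definite $\mathcal{R}$-lattice which is spanned up to finite index by its roots and has covering radius $\le 1$. Then $L=\Lambda\oplus II_{1,1}$ is reflective. Furthermore, if the covering radius is $<1$ then any two primitive isotropic vectors of $L$ are equivalent, up to a scalar, under $\mathrm{Reflec}\,L$ (that is, for any two such vectors $v,w$ there are $g\in\mathrm{Reflec}\,L$ and a unit $\alpha$ of $\mathcal{R}$ with $g(v)=w\alpha$).
   Context: $\mathcal{G}=\mathbb{Z}[i]$; $\mathcal{E}=\mathbb{Z}[\omega]$ with $\omega=(-1+\sqrt{-3})/2$; $\mathcal{H}$ is the ring of Hurwitz integers, the integral span of $\pm1,\pm i,\pm j,\pm k,(\pm1\pm i\pm j\pm k)/2$ in the quaternions $\mathbb{H}$. $\mathbb{K}=\mathbb{C}$ or $\mathbb{H}$ accordingly. An $\mathcal{R}$-lattice is a free right $\mathcal{R}$-module of finite rank with a biadditive pairing $\langle\cdot|\cdot\rangle$ to $\mathbb{K}$ satisfying $\langle x|y\rangle=\overline{\langle y|x\rangle}$ and $\langle x|y\alpha\rangle=\langle x|y\rangle\alpha$; all lattices are assumed integral (pairing valued in $\mathcal{R}$) and nonsingular. The norm of $v$ is $v^2=\langle v|v\rangle$; $v$ is isotropic if $v^2=0$. A nonzero $v\in L$ is primitive if $v=w\alpha$ with $w\in L$, $\alpha\in\mathcal{R}$ implies $\alpha$ is a unit. A root of a lattice is a vector of norm $1$ (short root) or norm $2$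 (long root). The covering radius of positive-definite $\Lambda$ is the maximal distance of a point of $\Lambda\otimes\mathbb{R}$ from $\Lambda$, for the metric $d(x,y)=\sqrt{(x-y)^2}$. For $r\in L\otimes\mathbb{R}$ of nonzero norm and a root of unity $\xi\neq1$ in $\mathbb{K}$, the $\xi$-reflection in $r$ is $v\mapsto v-r(1-\xi)\langle r|v\rangle/r^2$. $\mathrm{Reflec}\,L$ is the subgroup of $\mathrm{Aut}\,L$ generated by those elements of $\mathrm{Aut}\,L$ that are reflections in positive-norm vectors. $L$ is reflective if $\mathrm{Reflec}\,L$ has finite index in $\mathrm{Aut}\,L$. $II_{1,1}$ is $\mathcal{R}^2$ with inner product matrix $\begin{pmatrix}0&1\\1&0\end{pmatrix}$. *)

(* Defs.v *)
From HB Require Import structures.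
From mathcomp Require Import all_boot all_order all_algebra.
From mathcomp Require Import complex.
From mathcomp Require Import all_classical all_reals ereal ring.

Set Implicit Arguments.
Unset Strict Implicit.
Unset Printing Implicit Defensive.
Import Order.TTheory GRing.Theory Num.Theory.
Local Open Scope classical_set_scope.
Local Open Scope ring_scope.
Local Open Scope complex_scope.

(* [Quat a b c d] is the quaternion a + b i + c j + d k. *)
Record quat (R : Type) := Quat { qre : R; qi : R; qj : R; qk : R }.

Section QuaternionRing.
Variable R : realType.
Local Notation H := (quat R).

Definition quat_tuple (x : H) := (qre x, qi x, qj x, qk x).
Definition tuple_quat (p : R * R * R * R) : H :=
  let: (a, b, c, d) := p in Quat a b c d.
Lemma quat_tupleK : cancel quat_tuple tuple_quat. Proof. by case. Qed.
HB.instance Definition _ := Choice.copy H (can_type quat_tupleK).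

Definition quat_add (x y : H) :=
  Quat (qre x + qre y) (qi x + qi y) (qj x + qj y) (qk x + qk y).
Definition quat_opp (x : H) := Quat (- qre x) (- qi x) (- qj x) (- qk x).
Definition quat_zero : H := Quat 0 0 0 0.

Definition quat_one : H := Quat 1 0 0 0.
Definition quat_mul (x y : H) :=
  let: Quat a b c d := x in let: Quat a' b' c' d' := y in
  Quat (a * a' - b * b' - c * c' - d * d')
       (a * b' + b * a' + c * d' - d * c')
       (a * c' - b * d' + c * a' + d * b')
       (a * d' + b * c' - c * b' + d * a').

Fact quat_addA : associative quat_add.
Proof. by move=> [????] [????] [????]; congr Quat; rewrite /= addrA. Qed.
Fact quat_addC : commutative quat_add.
Proof. by move=> [????] [????]; congr Quat; rewrite /= addrC. Qed.
Fact quat_add0 : left_id quat_zero quat_add.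
Proof. by move=> [????]; congr Quat; rewrite /= add0r. Qed.
Fact quat_addN : left_inverse quat_zero quat_opp quat_add.
Proof. by move=> [????]; congr Quat; rewrite /= addNr. Qed.
HB.instance Definition _ :=
  GRing.isZmodule.Build H quat_addA quat_addC quat_add0 quat_addN.

Fact quat_mulA : associative quat_mul.
Proof. by move=> [????] [????] [????]; congr Quat; ring. Qed.
Fact quat_mul1l : left_id quat_one quat_mul.
Proof. by move=> [????]; congr Quat; ring. Qed.
Fact quat_mul1r : right_id quat_one quat_mul.
Proof. by move=> [????]; congr Quat; ring. Qed.
Fact quat_mulDl : left_distributive quat_mul quat_add.
Proof. by move=> [????] [????] [????]; congr Quat => /=; ring. Qed.
Fact quat_mulDr : right_distributive quat_mul quat_add.
Proof. by move=> [????] [????] [????]; congr Quat => /=; ring. Qed.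
Fact quat_1neq0 : quat_one != 0.
Proof. by apply/eqP => -[/eqP]; rewrite oner_eq0. Qed.
HB.instance Definition _ := GRing.Zmodule_isNzRing.Build H
  quat_mulA quat_mul1l quat_mul1r quat_mulDl quat_mulDr quat_1neq0.

Definition quat_conj (x : H) : H := Quat (qre x) (- qi x) (- qj x) (- qk x).

(* The 24 vectors +-1, +-i, +-j, +-k, (+-1 +-i +-j +-k)/2. *)
Definition hurwitz_gens : seq H :=
  let pm : seq R := [:: 1; -1] in
  [seq Quat s 0 0 0 | s <- pm] ++ [seq Quat 0 s 0 0 | s <- pm] ++
  [seq Quat 0 0 s 0 | s <- pm] ++ [seq Quat 0 0 0 s | s <- pm] ++
  [seq x + y | x <- [seq Quat (a / 2) (b / 2) 0 0 | a <- pm, b <- pm],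
               y <- [seq Quat 0 0 (c / 2) (d / 2) | c <- pm, d <- pm]].

End QuaternionRing.

Inductive ring_kind := Gaussian | Eisenstein | Hurwitz.

Section Scalars.
Variable R : realType.

Definition scalars (t : ring_kind) : nzRingType :=
  match t with Hurwitz => quat R | _ => R[i] end.

Definition sconj (t : ring_kind) : scalars t -> scalars t :=
  match t with
  | Hurwitz => @quat_conj R
  | Gaussian | Eisenstein => @conjc R
  end.

Definition realpart (t : ring_kind) : scalars t -> R :=
  match t with
  | Hurwitz => @qre R
  | Gaussian | Eisenstein => @complex.Re R
  end.

Definition of_real (t : ring_kind) : R -> scalars t :=
  match t with
  | Hurwitz => fun a => Quat a 0 0 0
  | Gaussian | Eisenstein => fun a => a +i* 0
  end.

Definition omega : R[i] := (- (1 / 2)) +i* (Num.sqrt 3 / 2).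

Definition integers (t : ring_kind) : set (scalars t) :=
  match t with
  | Gaussian => [set z : R[i] | inIntSpan [tuple 1; 'i] z]
  | Eisenstein => [set z : R[i] | inIntSpan [tuple 1; omega] z]
  | Hurwitz => [set q : quat R | inIntSpan (in_tuple (hurwitz_gens R)) q]
  end.

End Scalars.

(* A subgroup H of a group G with law op has finite index: it has finitely
   many left cosets. *)
Definition finite_index (T : Type) (op : T -> T -> T) (G H : set T) : Prop :=
  finite_set [set [set op g h | h in H] | g in G].

(* A free right module of rank n is identified with column vectors via a
   basis, and a pairing is given by its Gram matrix A in this basis.  The
   lattice itself is [lattice_points], inside the column vectors over K, which
   form its real span. *)
Section Lattices.
Variables (R : realType) (t : ring_kind).
Local Notation K := (scalars R t).
Local Notation O := (@integers R t).

Definition is_unit (a : K) : Prop :=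
  O a /\ exists b, [/\ O b, a * b = 1 & b * a = 1].

(* MathComp only scales matrices on the left; this is v |-> v a. *)
Definition rscale n (v : 'cV[K]_n) (a : K) : 'cV[K]_n := v *m a%:M.

Definition lattice_points n : set 'cV[K]_n := [set v | forall i, O (v i 0)].
Arguments lattice_points : clear implicits.

Section Form.
Variables (n : nat) (A : 'M[K]_n).
Implicit Types (v w x y r : 'cV[K]_n) (g : 'M[K]_n).

Definition pairing x y : K := ((map_mx (@sconj R t) x)^T *m A *m y) 0 0.

(* For a Hermitian pairing, <v|v> is real, hence equal to its real part. *)
Definition norm v : R := realpart (pairing v v).

Definition is_lattice : Prop :=
  [/\ forall x y, pairing x y = sconj (pairing y x),
      forall x y, lattice_points n x -> lattice_points n y ->
        O (pairing x y) &
      forall x, lattice_points n x ->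
        (forall y, lattice_points n y -> pairing x y = 0) -> x = 0].

Definition positive_definite : Prop := forall v, v != 0 -> 0 < norm v.

Definition roots : set 'cV[K]_n :=
  [set r | lattice_points n r /\ (norm r = 1 \/ norm r = 2)].

Definition is_submodule (M : set 'cV[K]_n) : Prop :=
  [/\ M 0, forall v w, M v -> M w -> M (v + w) &
      forall v a, M v -> O a -> M (rscale v a)].

Definition root_span : set 'cV[K]_n := smallest is_submodule roots.

Definition covering_radius : \bar R :=
  ereal_sup [set ereal_inf [set (Num.sqrt (norm (x - l)))%:E
                           | l in lattice_points n] | x in [set: 'cV[K]_n]].

Definition isotropic v : Prop := norm v = 0.

Definition primitive v : Prop :=
  [/\ lattice_points n v, v != 0 &
      forall w a, lattice_points n w -> O a -> v = rscale w a -> is_unit a].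

(* Endomorphisms of the right module of columns are left multiplications. *)
Definition integral_mx : set 'M[K]_n := [set g | forall i j, O (g i j)].

Definition Aut : set 'M[K]_n :=
  [set g | [/\ integral_mx g,
               exists h, [/\ integral_mx h, g *m h = 1%:M & h *m g = 1%:M] &
               forall x y, pairing (g *m x) (g *m y) = pairing x y]].

Definition root_of_unity (xi : K) : Prop := exists m, xi ^+ m.+1 = 1.

Definition reflection (xi : K) r v : 'cV[K]_n :=
  v - rscale r ((1 - xi) * pairing r v * of_real t (norm r)^-1).

(* r ranges over all positive-norm vectors of the real span of the lattice. *)
Definition reflections : set 'M[K]_n :=
  [set g | exists r xi, [/\ 0 < norm r, root_of_unity xi, xi != 1 &
                            forall v, g *m v = reflection xi r v]].

Definition is_subgroup (S : set 'M[K]_n) : Prop :=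
  [/\ S 1%:M, forall g h, S g -> S h -> S (g *m h) &
      forall g h, S g -> g *m h = 1%:M -> h *m g = 1%:M -> S h].

Definition Reflec : set 'M[K]_n := smallest is_subgroup (Aut `&` reflections).

Definition reflective : Prop := finite_index (@mulmx K n n n) Aut Reflec.

End Form.

Definition II11 : 'M[K]_2 := \matrix_(i, j) (i != j)%:R.

Definition orthogonal_sum m n (A : 'M[K]_m) (B : 'M[K]_n) : 'M[K]_(m + n) :=
  block_mx A 0 0 B.

End Lattices.

Arguments lattice_points R t n : clear implicits.
Arguments II11 R t : clear implicits.

(* Main.v *)
Require Import Defs.
From HB Require Import structures.
From mathcomp Require Import all_boot all_order all_algebra.
From mathcomp Require Import complex ring lra zify.
From mathcomp Require Import all_classical all_reals ereal.

(** Write a vector of L as (x; m, a), with x in the span of Lambda, so that its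
norm is x^2 + 2 Re(conj m a).  The number m is its height, and the isotropic
vectors of height 0 are the multiples of rho = (0; 0, 1).

The proof is a Euclidean algorithm on heights.  An isotropic vector v of height
m <> 0 is a multiple of (x; 1, y), where Re y = - x^2 / 2.  If l is a point of
Lambda at distance less than 1 from x, there is a short or long root (l; 1, b)
of L with a reflection turning v into a vector of smaller height; the choice of b amounts to
rounding in the lattice of imaginary integers ([reduce_ht], from the
arithmetic of [reducing_root_exists]).  If the covering radius is less than 1
this always works, so the height drops to 0 by descent: every primitive
isotropic vector is carried to a unit multiple of rho by Reflec L
([transitive_isotropic]).

If the covering radius is 1, the descent can only stop when x is a deep hole
of Lambda, at distance exactly 1 from the nearest lattice points, and then
the imaginary part of y is pinned down up to a lattice ([minimal_far]).  A deep
hole is determined by the lattice points at distance 1 from it, for otherwise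
it could be pushed away from Lambda ([deep_hole_rigid]); since Lambda is
locally finite, there are finitely many deep holes up to translation.  So
Reflec L has finitely many orbits on the lines spanned by the images of rho
under Aut L ([cusp_classes]), once it is known to contain enough
translations.

The group Reflec L contains, up to finite index, all the Heisenberg
translations fixing rho.  Those that move points of Lambda come from pairs of
parallel mirrors, defined by roots (r; 0, 0) and (r; 0, q) with r a root of
Lambda ([lattice_translations]); here the hypothesis on the root span is used.
Those in the centre of the Heisenberg group come from the roots (0; 1, b),
through relations in a group like SL_2(Z) ([central_imaginary]).  Hence Reflec
L meets the stabilizer of the line of rho in a subgroup of finite index in the
stabilizer in Aut L ([stabilizer_classes]).  Finitely many orbits and finite
index in the stabilizer give finite index in Aut L, because Reflec L is normal
([reflective_sum]). *)

Set Implicit Arguments.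
Unset Strict Implicit.
Unset Printing Implicit Defensive.
Import Order.TTheory GRing.Theory Num.Theory.
Local Open Scope classical_set_scope.
Local Open Scope ring_scope.

(** * Coordinates on the three rings of integers *)

Section IntSpan.
Variables (V : zmodType) (m : nat) (s : m.-tuple V).

Lemma inIntSpanD v w : inIntSpan s v -> inIntSpan s w -> inIntSpan s (v + w).
Proof.
move=> [a ->] [b ->]; exists [ffun i => a i + b i].
by rewrite -big_split; apply: eq_bigr => i _; rewrite ffunE mulrzDr.
Qed.

Lemma inIntSpanMz v (z : int) : inIntSpan s v -> inIntSpan s (v *~ z).
Proof.
move=> [a ->]; exists [ffun i => a i * z].
by rewrite mulrz_suml; apply: eq_bigr => i _; rewrite ffunE mulrzA.
Qed.

Lemma mem_inIntSpan v : v \in val s -> inIntSpan s v.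
Proof.
move=> vs; pose k := index v s.
have km : (k < m)%N by rewrite -[X in (_ < X)%N](size_tuple s) index_mem.
exists [ffun i => (i == Ordinal km)%:R].
rewrite (bigD1 (Ordinal km)) //= big1 => [|i /negPf ik]; rewrite ffunE ?ik ?eqxx.
  by rewrite addr0 mulr1z nth_index.
by rewrite mulr0z.
Qed.

Lemma inIntSpan_ind (P : V -> Prop) :
    P 0 -> (forall v w, P v -> P w -> P (v + w)) -> (forall v, P v -> P (- v)) ->
    {in val s, forall v, P v} -> forall v, inIntSpan s v -> P v.
Proof.
move=> P0 PD PN Ps _ [a ->].
elim/big_ind: _ => // i _.
have : P s`_i by apply: Ps; rewrite mem_nth ?size_tuple.
move: s`_i (a i) => v; have Pn k : P v -> P (v *+ k).
  by move=> Pv; elim: k => [|k IH]; rewrite ?mulr0n// mulrS; apply: PD.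
by case=> k Pv; rewrite ?NegzE ?mulrNz; [|apply: PN]; apply: Pn.
Qed.

End IntSpan.

Section Scalars.
Variable R : realType.
Local Open Scope complex_scope.

Lemma complex_ext (x y : R[i]) : complex.Re x = complex.Re y ->
  complex.Im x = complex.Im y -> x = y.
Proof. by case: x => ??; case: y => ?? /= -> ->. Qed.

Lemma quat_ext (x y : quat R) : qre x = qre y -> qi x = qi y -> qj x = qj y ->
  qk x = qk y -> x = y.
Proof. by case: x => ????; case: y => ???? /= -> -> -> ->. Qed.

Section Basics.
Variable t : ring_kind.
Local Notation K := (scalars R t).
Implicit Types (a b : K) (x y : R).

Fact sconj_is_zmod_morphism : zmod_morphism (@sconj R t).
Proof.
case: t => [[??] [??]|[??] [??]|[????] [????]]; last by apply: quat_ext => /=; ring.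
all: by apply: complex_ext => /=; ring.
Qed.
Fact realpart_is_zmod_morphism : zmod_morphism (@realpart R t).
Proof. by case: t => [[??] [??]|[??] [??]|[????] [????]]. Qed.
Fact of_real_is_zmod_morphism : zmod_morphism (@of_real R t).
Proof.
by case: t => ??;
  [apply: complex_ext|apply: complex_ext|apply: quat_ext] => /=; ring.
Qed.
Fact of_real_is_monoid_morphism : monoid_morphism (@of_real R t).
Proof.
by case: t; split=> [|??] //;
  [apply: complex_ext|apply: complex_ext|apply: quat_ext] => /=; ring.
Qed.

HB.instance Definition _ :=
  GRing.isZmodMorphism.Build K K (@sconj R t) sconj_is_zmod_morphism.
HB.instance Definition _ :=
  GRing.isZmodMorphism.Build K R (@realpart R t) realpart_is_zmod_morphism.
HB.instance Definition _ :=
  GRing.isZmodMorphism.Build R K (@of_real R t) of_real_is_zmod_morphism.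
HB.instance Definition _ :=
  GRing.isMonoidMorphism.Build R K (@of_real R t) of_real_is_monoid_morphism.

Lemma sconjK : involutive (@sconj R t).
Proof.
by case: t => [[??]|[??]|[????]];
  [apply: complex_ext|apply: complex_ext|apply: quat_ext] => /=; ring.
Qed.

Lemma sconjM a b : sconj (a * b) = sconj b * sconj a.
Proof.
case: t a b => [[??] [??]|[??] [??]|[????] [????]];
  by [apply: complex_ext => /=; ring|apply: quat_ext => /=; ring].
Qed.

Lemma sconj_real x : sconj (of_real t x) = of_real t x.
Proof.
by case: t; [apply: complex_ext|apply: complex_ext|apply: quat_ext] => /=; ring.
Qed.

Lemma sconj1 : sconj (1 : K) = 1.
Proof. by rewrite -(rmorph1 (@of_real R t)) sconj_real. Qed.

Lemma of_realC x a : of_real t x * a = a * of_real t x.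
Proof.
case: t a => [[??]|[??]|[????]];
  by [apply: complex_ext => /=; ring|apply: quat_ext => /=; ring].
Qed.

Lemma re_real x : realpart (of_real t x) = x.
Proof. by case: t. Qed.

Lemma re_conj a : realpart (sconj a) = realpart a.
Proof. by case: t a => [[??]|[??]|[????]]. Qed.

Lemma re_mulC a b : realpart (a * b) = realpart (b * a).
Proof. by case: t a b => [[??] [??]|[??] [??]|[????] [????]] /=; ring. Qed.

Lemma re_realM x a : realpart (of_real t x * a) = x * realpart a.
Proof. by case: t a => [[??]|[??]|[????]] /=; ring. Qed.

Lemma add_conj a : a + sconj a = of_real t (2 * realpart a).
Proof.
case: t a => [[??]|[??]|[????]];
  by [apply: complex_ext => /=; ring|apply: quat_ext => /=; ring].
Qed.

(** The squared absolute value. *)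
Definition sqn a : R := realpart (sconj a * a).

Lemma mul_conj a : sconj a * a = of_real t (sqn a).
Proof.
rewrite /sqn; case: t a => [[??]|[??]|[????]];
  by [apply: complex_ext => /=; ring|apply: quat_ext => /=; ring].
Qed.

Lemma sqn_conj a : sqn (sconj a) = sqn a.
Proof. by rewrite /sqn sconjK re_mulC. Qed.

Lemma mul_conjC a : a * sconj a = of_real t (sqn a).
Proof. by rewrite -{1}(sconjK a) mul_conj sqn_conj. Qed.

Lemma sqnM a b : sqn (a * b) = sqn a * sqn b.
Proof.
rewrite {1}/sqn sconjM -mulrA (mulrA (sconj a)) mul_conj mulrA.
by rewrite -(of_realC _ (sconj b)) -mulrA re_realM.
Qed.

Lemma sqn_real x : sqn (of_real t x) = x ^+ 2.
Proof. by rewrite /sqn sconj_real re_realM re_real expr2. Qed.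

Lemma sqn1 : sqn 1 = 1.
Proof. by rewrite -(rmorph1 (@of_real R t)) sqn_real expr1n. Qed.

Lemma sqn_ge_re a : realpart a ^+ 2 <= sqn a.
Proof. by rewrite /sqn; case: t a => [[??]|[??]|[????]] /=; nra. Qed.

Lemma sqn_ge0 a : 0 <= sqn a.
Proof. exact: le_trans (sqr_ge0 _) (sqn_ge_re a). Qed.

Lemma sqn_gt0 a : (0 < sqn a) = (a != 0).
Proof.
rewrite lt_def sqn_ge0 andbT; congr (~~ _); apply/eqP/eqP => [|->]; last first.
  by rewrite /sqn mulr0 raddf0.
have s0 (x y : R) : x * x + y = 0 -> 0 <= y -> x = 0 /\ y = 0.
  move=> xy y0; have := sqr_ge0 x; rewrite expr2 => x0.
  have x00 : x * x = 0 by lra.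
  by split; [apply/eqP; rewrite -sqrf_eq0 expr2 x00|lra].
rewrite /sqn; case: t a => [[a b]|[a b]|[a b c d]] /= E.
- have [-> b0] : a = 0 /\ b * b = 0 by apply: s0; nra.
  by have [->] : b = 0 /\ (0 : R) = 0 by apply: s0; lra.
- have [-> b0] : a = 0 /\ b * b = 0 by apply: s0; nra.
  by have [->] : b = 0 /\ (0 : R) = 0 by apply: s0; lra.
have [a0 E1] : a = 0 /\ b * b + (c * c + d * d) = 0 by apply: s0; nra.
have [b0 E2] : b = 0 /\ c * c + d * d = 0 by apply: s0; nra.
have [c0 E3] : c = 0 /\ d * d = 0 by apply: s0; nra.
have [d0 _] : d = 0 /\ (0 : R) = 0 by apply: s0; lra.
by rewrite a0 b0 c0 d0.
Qed.

(** Inverses are built from conjugates, the scalars being given only as a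
ring. *)
Definition sinv a : K := sconj a * of_real t (sqn a)^-1.

Lemma mulVs a : a != 0 -> sinv a * a = 1.
Proof.
move=> a0; rewrite /sinv -mulrA of_realC mulrA mul_conj -rmorphM.
by rewrite mulfV ?rmorph1// gt_eqF ?sqn_gt0.
Qed.

Lemma mulsV a : a != 0 -> a * sinv a = 1.
Proof.
move=> a0; rewrite /sinv mulrA mul_conjC -rmorphM.
by rewrite mulfV ?rmorph1// gt_eqF ?sqn_gt0.
Qed.

Lemma of_real_int (z : int) : of_real t z%:~R = z%:~R :> K.
Proof. by rewrite rmorph_int. Qed.

End Basics.

(** Coordinates in the Z-bases 1, i of the Gaussian integers, 1, omega of the
Eisenstein integers, and (1+i+j+k)/2, i, j, k of the Hurwitz integers.  The
common coordinate type makes it possible to argue for the three rings at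
once. *)
Definition intcoord (t : ring_kind) (a b c d : int) : scalars R t :=
  match t with
  | Gaussian => a%:~R +i* b%:~R
  | Eisenstein => (a%:~R - b%:~R / 2) +i* (b%:~R * (Num.sqrt 3 / 2))
  | Hurwitz => Quat (a%:~R / 2) (a%:~R / 2 + b%:~R) (a%:~R / 2 + c%:~R)
                    (a%:~R / 2 + d%:~R)
  end.

Lemma intcoordD t a b c d a' b' c' d' :
  intcoord t (a + a') (b + b') (c + c') (d + d') =
  intcoord t a b c d + intcoord t a' b' c' d'.
Proof.
by case: t; [apply: complex_ext|apply: complex_ext|apply: quat_ext]; rewrite /= !intrD; lra.
Qed.

Lemma intcoordN t a b c d : intcoord t (- a) (- b) (- c) (- d) = - intcoord t a b c d.
Proof.
by case: t; [apply: complex_ext|apply: complex_ext|apply: quat_ext]; rewrite /= !intrN; lra.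
Qed.

Lemma intcoord_mul t a b c d a' b' c' d' : exists p q r s,
  intcoord t a b c d * intcoord t a' b' c' d' = intcoord t p q r s.
Proof.
case: t.
- exists (a * a' - b * b'), (a * b' + b * a'), 0, 0.
  by apply: complex_ext => /=; ring.
- exists (a * a' - b * b'), (a * b' + b * a' - b * b'), 0, 0.
  have s3 : Num.sqrt 3 ^+ 2 = 3 :> R by rewrite sqr_sqrtr.
  by apply: complex_ext => /=; field : s3.
- pose S := b * b' + c * c' + d * d'.
  exists (- a * a' - (a * b' + b * a' + (a * c' + c * a') + (a * d' + d * a'))
          - S - S).
  exists (a * a' + a * b' + a' * b + a * d' + c * a' + c * d' - d * c' + S).
  exists (a * a' + a * c' + a' * c + a * b' + d * a' + d * b' - b * d' + S).
  exists (a * a' + a * d' + a' * d + a * c' + b * a' + b * c' - c * b' + S).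
  by apply: quat_ext; rewrite /= /S; field.
Qed.

Lemma intcoord_conj t a b c d : exists p q r s,
  sconj (intcoord t a b c d) = intcoord t p q r s.
Proof.
case: t.
- by exists a, (- b), 0, 0; apply: complex_ext => /=; ring.
- by exists (a - b), (- b), 0, 0; apply: complex_ext => /=; field.
- by exists a, (- a - b), (- a - c), (- a - d); apply: quat_ext => /=; field.
Qed.

Lemma intcoord1 t : intcoord t (if t is Hurwitz then 2 else 1)
  (if t is Hurwitz then - 1 else 0) (if t is Hurwitz then - 1 else 0)
  (if t is Hurwitz then - 1 else 0) = 1.
Proof.
by case: t; [apply: complex_ext|apply: complex_ext|apply: quat_ext] => /=; field.
Qed.

(** Each of the 24 Hurwitz units is seen to have integral coordinates from the
fact that two signs differ by an even integer. *)
Lemma intcoord_hurwitz_gens : {in hurwitz_gens R, forall x, exists a b c d,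
  x = intcoord Hurwitz a b c d}.
Proof.
have pm (s : R) : s \in [:: 1; -1] -> exists e : int, s = e%:~R.
  by rewrite !inE => /orP[/eqP ->|/eqP ->]; [exists 1|exists (-1)].
have pm2 (s r : R) : s \in [:: 1; -1] -> r \in [:: 1; -1] ->
    exists e : int, r / 2 = s / 2 + e%:~R.
  rewrite !inE => /orP[/eqP ->|/eqP ->] /orP[/eqP ->|/eqP ->];
    by [exists 0; field|exists (-1); field|exists 1; field].
move=> x; rewrite /hurwitz_gens 4!mem_cat.
case/or4P => [/mapP[_ /pm[e ->] ->]|/mapP[_ /pm[e ->] ->]|
  /mapP[_ /pm[e ->] ->]|/orP[/mapP[_ /pm[e ->] ->]|]].
- by exists (e * 2), (- e), (- e), (- e); apply: quat_ext => /=; field.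
- by exists 0, e, 0, 0; apply: quat_ext => /=; field.
- by exists 0, 0, e, 0; apply: quat_ext => /=; field.
- by exists 0, 0, 0, e; apply: quat_ext => /=; field.
case/allpairsPdep => y [z [/allpairsPdep[a [b [ap bp ->]]]]].
case/allpairsPdep => c [d [cp dp ->]] ->.
have [p ap'] := pm _ ap.
have [q bp'] := pm2 _ _ ap bp; have [r cp'] := pm2 _ _ ap cp.
have [s dp'] := pm2 _ _ ap dp.
by exists p, q, r, s; apply: quat_ext; rewrite /= ?add0r ?addr0 ?ap' // -?ap'.
Qed.

(** With a basis instead of the 24 Hurwitz generators, products and conjugates
can be computed in coordinates. *)
Lemma integersP t (z : scalars R t) :
  integers z <-> exists a b c d, z = intcoord t a b c d.
Proof.
have gen : forall m (s : m.-tuple (scalars R t)),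
    {in val s, forall v, exists a b c d, v = intcoord t a b c d} ->
    forall v, inIntSpan s v -> exists a b c d, v = intcoord t a b c d.
  move=> m s sP; apply: inIntSpan_ind => //.
  - by exists 0, 0, 0, 0; rewrite -[LHS](subrr (intcoord t 0 0 0 0)) -intcoordN -intcoordD.
  - move=> _ _ [a [b [c [d ->]]]] [a' [b' [c' [d' ->]]]].
    by exists (a + a'), (b + b'), (c + c'), (d + d'); rewrite intcoordD.
  - move=> _ [a [b [c [d ->]]]].
    by exists (- a), (- b), (- c), (- d); rewrite intcoordN.
split.
  case: t z gen => z gen /=; apply: gen.
  - move=> v; rewrite !inE => /orP[/eqP ->|/eqP ->].
      by exists 1, 0, 0, 0; apply: complex_ext => /=.
    by exists 0, 1, 0, 0; apply: complex_ext => /=.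
  - move=> v; rewrite !inE => /orP[/eqP ->|/eqP ->].
      by exists 1, 0, 0, 0; apply: complex_ext => /=; field.
    by exists 0, 1, 0, 0; apply: complex_ext => /=; field.
  - exact: intcoord_hurwitz_gens.
case=> a [b [c [d ->]]] {z gen}.
case: t => /=.
- have -> : a%:~R +i* b%:~R = 1 *~ a + 'i%C *~ b :> R[i].
    rewrite -[1 *~ a]mulrzr -['i%C *~ b]mulrzr.
    rewrite -(of_real_int Gaussian a) -(of_real_int Gaussian b). apply: complex_ext => /=; ring.
  by apply: inIntSpanD; apply/inIntSpanMz/mem_inIntSpan; rewrite !inE eqxx ?orbT.
- have -> : (a%:~R - b%:~R / 2) +i* (b%:~R * (Num.sqrt 3 / 2)) =
            1 *~ a + omega R *~ b.
    rewrite -[1 *~ a]mulrzr -[omega R *~ b]mulrzr.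
    by rewrite -(of_real_int Eisenstein a) -(of_real_int Eisenstein b);
      apply: complex_ext => /=; field.
  by apply: inIntSpanD; apply/inIntSpanMz/mem_inIntSpan; rewrite !inE eqxx ?orbT.
pose g (x y z w : R) := Quat x y z w.
have -> : Quat (a%:~R / 2) (a%:~R / 2 + b%:~R) (a%:~R / 2 + c%:~R)
    (a%:~R / 2 + d%:~R) = (g (1 / 2) (1 / 2) 0 0 + g 0 0 (1 / 2) (1 / 2)) *~ a
    + g 0 1 0 0 *~ b + g 0 0 1 0 *~ c + g 0 0 0 1 *~ d :> quat R.
  have E (x : quat R) (m : int) : x *~ m = x * of_real Hurwitz m%:~R.
    by rewrite of_real_int mulrzr.
  rewrite !E.
  by apply: quat_ext => /=; field.
have pm1 : 1 \in [:: 1; -1 : R] by rewrite inE eqxx.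
do 3?[apply: inIntSpanD]; apply/inIntSpanMz/mem_inIntSpan;
  rewrite /= /hurwitz_gens 4!mem_cat.
- by apply/or4P; constructor 4; apply/orP; right; apply: allpairs_f;
    [apply: (allpairs_f (fun a b => Quat (a / 2) (b / 2) 0 0))
    |apply: (allpairs_f (fun a b => Quat 0 0 (a / 2) (b / 2)))].
- by rewrite [X in _ || (X || _)](map_f (fun s => Quat 0 s 0 0)) ?orbT.
- by rewrite [X in _ || (_ || (X || _))](map_f (fun s => Quat 0 0 s 0)) ?orbT.
- by rewrite [X in _ || (_ || (_ || (X || _)))](map_f (fun s => Quat 0 0 0 s))
    ?orbT.
Qed.

End Scalars.

(** * Arithmetic of the rings of integers *)

Section Integers.
Variables (R : realType) (t : ring_kind).
Local Notation K := (scalars R t).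
Local Notation O := (@integers R t).
Implicit Types (a b : K) (x y : R).

Lemma integersD a b : O a -> O b -> O (a + b).
Proof.
move=> /integersP[? [? [? [? ->]]]] /integersP[? [? [? [? ->]]]].
by apply/integersP; rewrite -intcoordD; do 4!eexists.
Qed.

Lemma integersN a : O a -> O (- a).
Proof.
move=> /integersP[? [? [? [? ->]]]].
by apply/integersP; rewrite -intcoordN; do 4!eexists.
Qed.

Lemma integersB a b : O a -> O b -> O (a - b).
Proof. by move=> Oa /integersN; apply: integersD. Qed.

Lemma integersM a b : O a -> O b -> O (a * b).
Proof.
move=> /integersP[? [? [? [? ->]]]] /integersP[? [? [? [? ->]]]].
exact/integersP/intcoord_mul.
Qed.

Lemma integers_conj a : O a -> O (sconj a).
Proof. by move=> /integersP[? [? [? [? ->]]]]; apply/integersP/intcoord_conj. Qed.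

Lemma integers1 : O 1.
Proof. by apply/integersP; rewrite -intcoord1; do 4!eexists. Qed.

Lemma integers0 : O 0.
Proof. by rewrite -(subrr 1); apply: integersB; apply: integers1. Qed.

Lemma integers_nat n : O n%:R.
Proof.
elim: n => [|n IH]; first exact: integers0.
by rewrite -natr1; apply: integersD => //; apply: integers1.
Qed.

Lemma integers_sum (I : Type) (r : seq I) (F : I -> K) :
  (forall i, O (F i)) -> O (\sum_(i <- r) F i).
Proof.
move=> OF; elim/big_ind: _ => //; first exact: integers0.
exact: integersD.
Qed.

(** This is the source of all discreteness below: it makes the norms of
lattice vectors, and the squared absolute values of heights, rational
integers. *)
Lemma integers_real x : O (of_real t x) -> exists z : int, x = z%:~R.
Proof.
move=> /integersP[a [b [c [d]]]].
case: t => /= -[].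
- by move=> ->; exists a.
- move=> -> /esym/eqP; rewrite mulf_eq0 intr_eq0 => /orP[/eqP ->|].
    by exists a; rewrite mul0r subr0.
  by rewrite mulf_eq0 invr_eq0 sqrtr_eq0 !pnatr_eq0 orbF leNgt ltr0n.
- move=> -> E _ _; exists (- b); rewrite intrN; lra.
Qed.

Lemma sqn_nat a : O a -> exists k : nat, sqn a = k%:R.
Proof.
move=> Oa; have : O (of_real t (sqn a)).
  by rewrite -mul_conj; apply: integersM => //; apply: integers_conj.
case/integers_real => -[k|k] E; first by exists k.
by have := sqn_ge0 a; rewrite E ler0z.
Qed.

(** The ring is a free Z-module of finite rank, so reduction of the coordinates
gives finitely many residues modulo M. *)
Lemma integers_mod M : (0 < M)%N -> exists F : set K,
  [/\ finite_set F, F `<=` O &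
      forall a, O a -> exists f q, [/\ F f, O q & a = f + q * M%:R]].
Proof.
move=> M0.
pose g (p : 'I_M * 'I_M * 'I_M * 'I_M) : K :=
  intcoord R t p.1.1.1%:Z p.1.1.2%:Z p.1.2%:Z p.2%:Z.
exists (g @` setT); split; first exact/finite_image/finite_finset.
  by move=> _ [p _ <-]; apply/integersP; do 4!eexists.
move=> _ /integersP[a [b [c [d ->]]]].
have E (x : int) : exists (q : int) (r : 'I_M), x = r%:Z + q * M%:Z.
  have M0' : M%:Z != 0 by rewrite -lt0n in M0 *; lia.
  have r0 := modz_ge0 x M0'.
  have rM : (`|(x %% M)%Z| < M)%N.
    have := ltz_mod x M0'; lia.
  exists (x %/ M)%Z, (Ordinal rM) => /=.
  by rewrite gez0_abs // addrC -divz_eq.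
have [qa [ra ->]] := E a; have [qb [rb ->]] := E b.
have [qc [rc ->]] := E c; have [qd [rd ->]] := E d.
exists (g (ra, rb, rc, rd)), (intcoord R t qa qb qc qd); split.
- by exists (ra, rb, rc, rd).
- by apply/integersP; do 4!eexists.
rewrite intcoordD; congr (_ + _).
have -> : (M%:R : K) = of_real t (M%:Z)%:~R by rewrite of_real_int.
by case: t; [apply: complex_ext|apply: complex_ext|apply: quat_ext] => /=; rewrite !intrM; ring.
Qed.

Lemma sqn_unit a : O a -> sqn a = 1 -> is_unit a.
Proof.
move=> Oa a1; split=> //; exists (sconj a).
by rewrite mul_conj mul_conjC a1 rmorph1; split=> //; apply: integers_conj.
Qed.

Lemma integers_unit a b : O a -> O b -> a * b = 1 -> is_unit a /\ sqn a = 1.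
Proof.
move=> Oa Ob ab; suff a1 : sqn a = 1 by split=> //; apply: sqn_unit.
have := sqnM a b; rewrite ab sqn1.
have [k ->] := sqn_nat Oa; have [l ->] := sqn_nat Ob.
by rewrite -natrM => /esym/eqP; rewrite -[1]/(1%:R) eqr_nat muln_eq1 => /andP[/eqP ->].
Qed.

Lemma root_of_unity_sqn a : Defs.root_of_unity a -> sqn a = 1.
Proof.
case=> m am; have aX (k : nat) : sqn (a ^+ k) = sqn a ^+ k.
  by elim: k => [|k IH]; rewrite ?sqn1// !exprS sqnM IH.
have := aX m.+1; rewrite am sqn1 => /esym/eqP.
by rewrite pexpr_eq1 ?sqn_ge0// => /eqP.
Qed.

Lemma round_int x : exists z : int, -1 / 2 <= x - z%:~R <= 1 / 2.
Proof.
exists (Num.floor (x + 1 / 2)).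
have := ge_floor (x + 1 / 2); have := lt_succ_floor (x + 1 / 2).
by rewrite intrD => ??; apply/andP; split; lra.
Qed.

Lemma root_of_unityN1 : Defs.root_of_unity (- 1 : K).
Proof. by exists 1%N; rewrite sqrrN expr1n. Qed.

End Integers.

(** * Rounding: the root that lowers a height *)

(** Let N be the norm of a point l of Lambda, and s = y + <l|x>.  The root
(l; 1, b) of norm c pairs with (x; 1, y) to s + conj b, so its xi-reflection
changes the height from 1 to the scalar whose squared absolute value is
required to be less than 1. *)
Definition has_reducing_root (R : realType) (t : ring_kind) (N : int) (s : scalars R t) :=
  exists (c : R) b xi,
  [/\ integers b, 2 * realpart b = c - N%:~R,
      (c = 2 /\ xi = - 1) \/
      [/\ c = 1, integers xi, Defs.root_of_unity xi & xi != 1] &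
      sqn (1 - (1 - xi) * (s + sconj b) * of_real t c^-1) < 1].

Section Arith.
Variable R : realType.
Local Open Scope complex_scope.

Lemma sqr_le_quarter (x : R) : -1 / 2 <= x <= 1 / 2 -> x ^+ 2 <= 1 / 4.
Proof. by move=> /andP[??]; rewrite expr2; nra. Qed.

Lemma sqr_eq_quarter (x : R) : x ^+ 2 = 1 / 4 ->
  exists e : int, [/\ e = 1 \/ e = - 1 & x = e%:~R / 2].
Proof.
move=> E; have : (x - 1 / 2) * (x + 1 / 2) = 0 by rewrite -[RHS](subrr (1/4)) -{1}E; field.
move/eqP; rewrite mulf_eq0 => /orP[] /eqP H; [exists 1|exists (-1)]; split; auto; lra.
Qed.

(** Let D be the squared distance N - 2 Re s from x to l.  A root of height 1
over an l of even norm is taken long.  Its biflection gives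
height D / 2 - w, where w is the imaginary part of s + conj b, and w can be
brought into [-1/2, 1/2] i.  If l has odd norm it is taken short, and the
reflection of multiplier i or - i, according to the sign of w, gives a height of
squared absolute value (D^2 + (2 |w| - 1)^2) / 2.  This is less than 1 unless
D = 1 and w = 0, when 2 s is integral. *)
Lemma reducing_gaussian (N : int) (s : scalars R Gaussian) :
  0 <= N%:~R - 2 * realpart s -> N%:~R - 2 * realpart s <= 1 ->
  N%:~R - 2 * realpart s < 1 \/ ~ integers (s + s) -> has_reducing_root N s.
Proof.
case: s => x y; rewrite -[realpart _]/x; set D := _ - _ => D0 D1 hyp.
have [q] := round_int y; set tt := y - _ => tb; have tb2 := sqr_le_quarter tb.
have [k [NE|NE]] : exists k : int, N = 2 * k \/ N = 2 * k + 1.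
  exists (N %/ 2)%Z; have := modz_ge0 N (isT : 2 != 0 :> int).
  have := ltz_mod N (isT : 2 != 0 :> int); have := divz_eq N 2; lia.
- exists 2, (intcoord R Gaussian (1 - k) q 0 0), (- 1); split.
  + by apply/integersP; do 4!eexists.
  + by rewrite /= NE; ring.
  + by left.
  have -> : sqn (1 - (1 - -1) * (x +i* y + sconj (intcoord R Gaussian (1 - k) q 0 0))
      * of_real Gaussian 2^-1 : scalars R Gaussian) = (D / 2) ^+ 2 + tt ^+ 2.
    by rewrite /sqn /= /D /tt NE; field.
  have : D * D <= 1 by nra. rewrite !expr2; lra.
have cases : 0 < tt \/ tt <= 0 by case: (ltP 0 tt); auto.
have strict : D < 1 \/ tt <> 0.
  case: hyp => [|h]; first by left.
  case: (ltP D 1) => [|D1']; first by left.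
  right=> t0; apply: h; apply/integersP; exists (k + k), (q + q), 0, 0.
  apply: complex_ext => /=; last by move: t0; rewrite /tt intrD; lra.
  by rewrite intrD; move: D1 D1'; rewrite /D NE intrD intrM; lra.
have sq : D * D <= 1 by nra.
case: cases => tpos.
- exists 1, (intcoord R Gaussian (- k) q 0 0), ('i%C : R[i]); split.
  + by apply/integersP; do 4!eexists.
  + by rewrite /= NE; ring.
  + right; split=> //.
    * by apply/integersP; exists 0, 1, 0, 0; apply: complex_ext.
    * by exists 3%N; apply: complex_ext => /=; ring.
    * by apply/eqP => -[/eqP]; rewrite eq_sym oner_eq0.
  have -> : sqn (1 - (1 - 'i%C) * (x +i* y + sconj (intcoord R Gaussian (- k) q 0 0))
      * of_real Gaussian 1^-1 : scalars R Gaussian) =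
      ((D * D) + (2 * tt - 1) ^+ 2) / 2.
    by rewrite /sqn /= /D /tt NE invr1; field.
  case/andP: tb => ? ?; rewrite expr2; nra.
- exists 1, (intcoord R Gaussian (- k) q 0 0), (- 'i%C : R[i]); split.
  + by apply/integersP; do 4!eexists.
  + by rewrite /= NE; ring.
  + right; split=> //.
    * by apply/integersP; exists 0, (-1), 0, 0; apply: complex_ext => /=; rewrite ?oppr0.
    * by exists 3%N; apply: complex_ext => /=; ring.
    * by apply/eqP => -[/eqP]; rewrite oppr0 eq_sym oner_eq0.
  have -> : sqn (1 - (1 - - 'i%C) * (x +i* y + sconj (intcoord R Gaussian (- k) q 0 0))
      * of_real Gaussian 1^-1 : scalars R Gaussian) =
      ((D * D) + (2 * tt + 1) ^+ 2) / 2.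
    by rewrite /sqn /= /D /tt NE invr1; field.
  case/andP: tb => ? ?; rewrite expr2.
  case: strict => [Dlt|/eqP t0]; last first.
    have tn : tt < 0 by rewrite lt_neqAle t0.
    have : tt * (tt + 1) < 0 by rewrite nmulr_rlt0 //; lra.
    lra.
  have : D * D <= D by rewrite ler_piMl // ltW.
  have : tt * (tt + 1) <= 0 by rewrite mulr_le0_ge0 //; lra.
  lra.
Qed.

(** The imaginary parts of the integers with given real part form a coset of
sqrt(3) Z, so the imaginary part of s + conj b can be made at most sqrt(3) / 2
in absolute value.  The biflection in the long root then gives a height of
squared absolute value at most 1/4 + 3/4, and equality forces 2 s to be
integral. *)
Lemma reducing_eisenstein (N : int) (s : scalars R Eisenstein) :
  0 <= N%:~R - 2 * realpart s -> N%:~R - 2 * realpart s <= 1 ->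
  N%:~R - 2 * realpart s < 1 \/ ~ integers (s + s) -> has_reducing_root N s.
Proof.
case: s => x y; rewrite -[realpart _]/x; set D := _ - _ => D0 D1 hyp.
(* The imaginary part in units of sqrt(3), the spacing of the coset. *)
pose z := y / Num.sqrt 3.
have s0 : Num.sqrt 3 != 0 :> R by rewrite sqrtr_eq0 -ltNge ltr0n.
have s3 : Num.sqrt 3 ^+ 2 = 3 :> R by rewrite sqr_sqrtr.
have yE : y = z * Num.sqrt 3 by rewrite divfK.
have [r] := round_int (z - N%:~R / 2); set tt := _ - r%:~R => tb.
have tb2 := sqr_le_quarter tb.
exists 2, (intcoord R Eisenstein (1 + r) (N + 2 * r) 0 0), (- 1); split.
- by apply/integersP; do 4!eexists.
- by rewrite /=; field.
- by left.
have -> : sqn (1 - (1 - -1) * (x +i* y + sconj (intcoord R Eisenstein (1 + r) (N + 2 * r) 0 0))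
      * of_real Eisenstein 2^-1 : scalars R Eisenstein) = (D / 2) ^+ 2 + 3 * tt ^+ 2.
  by rewrite /sqn /= /D /tt yE; field : s3.
have sq : D * D <= 1 by nra.
rewrite ltNge; apply/negP => ge1; rewrite expr2 in ge1.
have D1' : D = 1 by nra.
have [e [_ te]] : exists e : int, [/\ e = 1 \/ e = - 1 & tt = e%:~R / 2].
  by apply: sqr_eq_quarter; lra.
case: hyp; first by rewrite D1' ltxx.
apply; apply/integersP; exists (2 * N - 1 + 2 * r + e), (2 * N + 4 * r + 2 * e), 0, 0.
apply: complex_ext => /=.
  by move: D1'; rewrite /D => D1'; lra.
have zE : z = tt + N%:~R / 2 + r%:~R by rewrite /tt; ring.
by rewrite yE zE te; field.
Qed.

(** The imaginary parts of the Hurwitz integers with given real part form a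
coset of Z^3, whose deepest holes are at squared distance 3/4; so the bound is
again 1/4 + 3/4, and in the case of equality the components of 2 s are rational
integers. *)
Lemma reducing_hurwitz (N : int) (s : scalars R Hurwitz) :
  0 <= N%:~R - 2 * realpart s -> N%:~R - 2 * realpart s <= 1 ->
  N%:~R - 2 * realpart s < 1 \/ ~ integers (s + s) -> has_reducing_root N s.
Proof.
case: s => x y1 y2 y3; rewrite -[realpart _]/x; set D := _ - _ => D0 D1 hyp.
have [r1] := round_int (y1 - (1 - N%:~R / 2)); set t1 := _ - r1%:~R => /sqr_le_quarter tb1.
have [r2] := round_int (y2 - (1 - N%:~R / 2)); set t2 := _ - r2%:~R => /sqr_le_quarter tb2.
have [r3] := round_int (y3 - (1 - N%:~R / 2)); set t3 := _ - r3%:~R => /sqr_le_quarter tb3.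
exists 2, (intcoord R Hurwitz (2 - N) r1 r2 r3), (- 1); split.
- by apply/integersP; do 4!eexists.
- by rewrite /=; field.
- by left.
have -> : sqn (1 - (1 - -1) * (Quat x y1 y2 y3 + sconj (intcoord R Hurwitz (2 - N) r1 r2 r3))
      * of_real Hurwitz 2^-1 : scalars R Hurwitz) =
    (D / 2) ^+ 2 + t1 ^+ 2 + t2 ^+ 2 + t3 ^+ 2.
  by rewrite /sqn /= /D /t1 /t2 /t3; field.
have sq : D * D <= 1 by nra.
rewrite ltNge; apply/negP => ge1; rewrite [(D / 2) ^+ 2]expr2 in ge1.
have D1' : D = 1 by nra.
rewrite D1' in ge1 hyp.
have [|e1 [_ te1]] := @sqr_eq_quarter t1; first by lra.
have [|e2 [_ te2]] := @sqr_eq_quarter t2; first by lra.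
have [|e3 [_ te3]] := @sqr_eq_quarter t3; first by lra.
case: hyp; first by rewrite ltxx.
apply; apply/integersP.
exists (2 * N - 2), (e1 + 3 - 2 * N + 2 * r1), (e2 + 3 - 2 * N + 2 * r2),
  (e3 + 3 - 2 * N + 2 * r3).
have y1E : y1 = t1 + (1 - N%:~R / 2) + r1%:~R by rewrite /t1; ring.
have y2E : y2 = t2 + (1 - N%:~R / 2) + r2%:~R by rewrite /t2; ring.
have y3E : y3 = t3 + (1 - N%:~R / 2) + r3%:~R by rewrite /t3; ring.
apply: quat_ext => /=.
- by move: D1'; rewrite /D => D1'; lra.
- by rewrite y1E te1; field.
- by rewrite y2E te2; field.
- by rewrite y3E te3; field.
Qed.

Lemma reducing_root_exists t (N : int) (s : scalars R t) :
  0 <= N%:~R - 2 * realpart s -> N%:~R - 2 * realpart s <= 1 ->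
  N%:~R - 2 * realpart s < 1 \/ ~ integers (s + s) -> has_reducing_root N s.
Proof.
case: t s; [exact: reducing_gaussian|exact: reducing_eisenstein|].
exact: reducing_hurwitz.
Qed.
End Arith.

(** * Lattices, Hermitian forms and their reflections *)

Section Columns.
Variables (R : realType) (t : ring_kind).
Local Notation K := (scalars R t).
Local Notation O := (@integers R t).

Lemma rscaleE m (v : 'cV[K]_m) a i j : rscale v a i j = v i j * a.
Proof. by rewrite /rscale mxE big_ord1 mxE [j]ord1 eqxx mulr1n. Qed.

Lemma rscale_mul m p (g : 'M[K]_(p, m)) (v : 'cV_m) a :
  g *m rscale v a = rscale (g *m v) a.
Proof. by rewrite /rscale mulmxA. Qed.

Lemma rscaleA m (v : 'cV[K]_m) a b : rscale (rscale v a) b = rscale v (a * b).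
Proof. by apply/matrixP => i j; rewrite !rscaleE mulrA. Qed.

Lemma rscale1 m (v : 'cV[K]_m) : rscale v 1 = v.
Proof. by apply/matrixP => i j; rewrite !rscaleE mulr1. Qed.

Lemma rscale0 m (v : 'cV[K]_m) : rscale v 0 = 0.
Proof. by apply/matrixP => i j; rewrite !rscaleE mulr0 mxE. Qed.

Lemma rscaleDl m (v w : 'cV[K]_m) a : rscale (v + w) a = rscale v a + rscale w a.
Proof. by rewrite /rscale mulmxDl. Qed.

Lemma rscaleNl m (v : 'cV[K]_m) a : rscale (- v) a = - rscale v a.
Proof. by rewrite /rscale mulNmx. Qed.

Lemma rscaleDr m (v : 'cV[K]_m) a b : rscale v (a + b) = rscale v a + rscale v b.
Proof. by apply/matrixP => i j; rewrite rscaleE mxE !rscaleE mulrDr. Qed.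

Lemma rscaleNr m (v : 'cV[K]_m) a : rscale v (- a) = - rscale v a.
Proof. by apply/matrixP => i j; rewrite rscaleE mxE !rscaleE mulrN. Qed.

Lemma latticeD m (v w : 'cV[K]_m) : lattice_points R t m v ->
  lattice_points R t m w -> lattice_points R t m (v + w).
Proof. by move=> Lv Lw i; rewrite mxE; apply: integersD. Qed.

Lemma latticeN m (v : 'cV[K]_m) : lattice_points R t m v ->
  lattice_points R t m (- v).
Proof. by move=> Lv i; rewrite mxE; apply: integersN. Qed.

Lemma latticeB m (v w : 'cV[K]_m) : lattice_points R t m v ->
  lattice_points R t m w -> lattice_points R t m (v - w).
Proof. by move=> Lv /latticeN; apply: latticeD. Qed.

Lemma latticeZ m (v : 'cV[K]_m) a : lattice_points R t m v -> O a ->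
  lattice_points R t m (rscale v a).
Proof. by move=> Lv Oa i; rewrite rscaleE; apply: integersM. Qed.

Lemma lattice0 m : lattice_points R t m 0.
Proof. by move=> i; rewrite mxE; apply: integers0. Qed.

Lemma lattice_mul m p (g : 'M[K]_(p, m)) v : (forall i j, O (g i j)) ->
  lattice_points R t m v -> lattice_points R t p (g *m v).
Proof.
by move=> Og Lv i; rewrite mxE; apply: integers_sum => j; apply: integersM.
Qed.

Definition std m i : 'cV[K]_m := \col_j (j == i)%:R.

Lemma lattice_std m i : lattice_points R t m (std i).
Proof. by move=> j; rewrite mxE; apply: integers_nat. Qed.

Lemma cV_sum_std m (v : 'cV[K]_m) : v = \sum_i rscale (std i) (v i 0).
Proof.
apply/matrixP => i j; rewrite summxE (bigD1 i) //= big1 => [|k /negPf ki].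
  by rewrite rscaleE !mxE eqxx mul1r addr0 [j]ord1.
by rewrite rscaleE mxE eq_sym ki mul0r.
Qed.

Lemma mul_std m p (g : 'M[K]_(p, m)) i j : (g *m std i) j 0 = g j i.
Proof.
rewrite mxE (bigD1 i) //= big1 => [|k /negPf ki]; last by rewrite mxE ki mulr0.
by rewrite mxE eqxx mulr1 addr0.
Qed.

Lemma mul_mx_ext m p (g h : 'M[K]_(p, m)) :
  (forall v : 'cV_m, g *m v = h *m v) -> g = h.
Proof. by move=> gh; apply/matrixP => i j; rewrite -(mul_std g) gh mul_std. Qed.

Lemma integral_mul m p q (g : 'M[K]_(m, p)) (h : 'M[K]_(p, q)) :
  (forall i j, O (g i j)) -> (forall i j, O (h i j)) ->
  forall i j, O ((g *m h) i j).
Proof.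
by move=> Og Oh i j; rewrite mxE; apply: integers_sum => k; apply: integersM.
Qed.

Lemma integral_mx_lattice m (g : 'M[K]_m) :
  (forall v, lattice_points R t m v -> lattice_points R t m (g *m v)) ->
  integral_mx g.
Proof. by move=> Lg i j; rewrite -(mul_std g); apply/Lg/lattice_std. Qed.

End Columns.

Section Form.
Variables (R : realType) (t : ring_kind) (n : nat).
Local Notation K := (scalars R t).
Local Notation O := (@integers R t).
Variable A : 'M[K]_n.
Local Notation "<< x , y >>" := (pairing A x y).
Implicit Types (x y v w r : 'cV[K]_n) (g h : 'M[K]_n).

Lemma pairingDr x y z : <<x, y + z>> = <<x, y>> + <<x, z>>.
Proof. by rewrite /pairing mulmxDr mxE. Qed.

Lemma pairingZr x y a : <<x, rscale y a>> = <<x, y>> * a.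
Proof. by rewrite /pairing rscale_mul rscaleE. Qed.

Lemma pairing0r x : <<x, 0>> = 0.
Proof. by rewrite /pairing mulmx0 mxE. Qed.

Lemma pairingNr x y : <<x, - y>> = - <<x, y>>.
Proof. by rewrite /pairing mulmxN mxE. Qed.

Hypothesis herm : forall x y, <<x, y>> = sconj <<y, x>>.

Lemma pairingDl x y z : <<x + y, z>> = <<x, z>> + <<y, z>>.
Proof. by rewrite !(herm _ z) pairingDr raddfD. Qed.

Lemma pairingNl x y : <<- x, y>> = - <<x, y>>.
Proof. by rewrite !(herm _ y) pairingNr raddfN. Qed.

Lemma pairing0l y : <<0, y>> = 0.
Proof. by rewrite herm pairing0r raddf0. Qed.

Lemma pairingZl x y a : <<rscale x a, y>> = sconj a * <<x, y>>.
Proof. by rewrite !(herm _ y) pairingZr sconjM. Qed.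

Lemma pairing_norm x : <<x, x>> = of_real t (norm A x).
Proof.
have := add_conj <<x, x>>; rewrite -herm /norm => E.
have H : of_real t 2^-1 * (<<x, x>> + <<x, x>>) = <<x, x>>.
  rewrite mulrDr -mulrDl -rmorphD.
  by have -> : 2^-1 + 2^-1 = 1 :> R; [field|rewrite rmorph1 mul1r].
by rewrite -[LHS]H E -rmorphM mulrA mulVf ?pnatr_eq0// mul1r.
Qed.

Lemma normZ x a : norm A (rscale x a) = norm A x * sqn a.
Proof.
rewrite /norm pairingZr pairingZl pairing_norm -of_realC -mulrA re_realM.
by rewrite re_real.
Qed.

Lemma re_pairingC x y : realpart <<x, y>> = realpart <<y, x>>.
Proof. by rewrite herm re_conj. Qed.

Lemma normD x y : norm A (x + y) = norm A x + 2 * realpart <<x, y>> + norm A y.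
Proof.
rewrite /norm pairingDl !pairingDr !raddfD /= (re_pairingC y x).
by rewrite mulr_natl mulr2n !addrA.
Qed.

Lemma normN x : norm A (- x) = norm A x.
Proof. by rewrite /norm pairingNr pairingNl opprK. Qed.

Lemma normB x y : norm A (x - y) = norm A x - 2 * realpart <<x, y>> + norm A y.
Proof. by rewrite normD normN pairingNr raddfN mulrN. Qed.

Lemma norm0 : norm A 0 = 0.
Proof. by rewrite /norm pairing0r raddf0. Qed.

Lemma reflection_comp xi eta r v : norm A r != 0 ->
  reflection A xi r (reflection A eta r v) = reflection A (xi * eta) r v.
Proof.
move=> r0; set c := norm A r; rewrite /reflection -/c -addrA -opprD -rscaleDr.
congr (v - rscale r _); rewrite pairingDr pairingNr pairingZr pairing_norm -/c.
have -> : <<r, v>> - of_real t c * ((1 - eta) * <<r, v>> * of_real t c^-1) =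
          eta * <<r, v>>.
  rewrite of_realC -(mulrA _ (of_real t c^-1)) -rmorphM mulVf// rmorph1 mulr1.
  by rewrite mulrBl mul1r opprB addrC subrK.
by rewrite -mulrDl mulrA -mulrDl mulrBl mul1r addrA subrK.
Qed.

Lemma reflection1 r v : reflection A 1 r v = v.
Proof. by rewrite /reflection subrr !mul0r rscale0 subr0. Qed.

(** The cancellation behind this is
(1 - conj xi)(1 - xi) = (1 - xi) + (1 - conj xi), valid because |xi| = 1. *)
Lemma pairing_reflection xi r x y : norm A r != 0 -> sqn xi = 1 ->
  <<reflection A xi r x, reflection A xi r y>> = <<x, y>>.
Proof.
move=> r0 xi1; set c := norm A r; set p := <<r, x>>; set q := <<r, y>>.
rewrite /reflection -/c -/p -/q.
set X := (1 - xi) * p * _; set Y := (1 - xi) * q * _.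
have cY : of_real t c * Y = (1 - xi) * q.
  by rewrite /Y of_realC -[LHS]mulrA -rmorphM mulVf// rmorph1 mulr1.
have sX : sconj X = of_real t c^-1 * sconj p * (1 - sconj xi).
  by rewrite /X !sconjM sconj_real raddfB /= sconj1 mulrA.
have pY : sconj p * Y = of_real t c^-1 * sconj p * (1 - xi) * q.
  by rewrite /Y mulrA -of_realC !mulrA.
have xixi : (1 - sconj xi) * (1 - xi) = (1 - xi) + (1 - sconj xi).
  rewrite mulrBl mul1r; congr (_ + _).
  by rewrite mulrBr mulr1 mul_conj xi1 rmorph1 opprB.
have key : <<rscale r X, rscale r Y>> = <<x, rscale r Y>> + <<rscale r X, y>>.
  rewrite pairingZl pairingZr pairing_norm -/c cY pairingZr (herm x r) -/p pY.
  rewrite pairingZl -/q sX -[LHS]mulrA (mulrA (1 - sconj xi)) xixi.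
  by rewrite mulrDl mulrDr !mulrA.
rewrite !(pairingDr, pairingDl, pairingNr, pairingNl) key.
by rewrite opprK addKr subrK.
Qed.

Lemma reflection_mx xi r : exists g, forall v, g *m v = reflection A xi r v.
Proof.
exists (1%:M - r *m (((1 - xi) * of_real t (norm A r)^-1)%:M *m
  ((map_mx (@sconj R t) r)^T *m A))) => v.
rewrite mulmxBl mul1mx /reflection /rscale -!mulmxA; congr (_ - _ *m _).
rewrite mul_scalar_mx [X in _ *: X]mx11_scalar scale_scalar_mx mulmxA.
rewrite -/(pairing A r v); congr (_%:M).
by rewrite -[LHS]mulrA of_realC mulrA.
Qed.

Lemma reflection_isom xi r g : norm A r != 0 ->
  (forall x y, <<g *m x, g *m y>> = <<x, y>>) ->
  forall v, g *m reflection A xi r v = reflection A xi (g *m r) (g *m v).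
Proof.
move=> r0 gi v; rewrite /reflection mulmxBr rscale_mul gi.
by rewrite [norm A (g *m r)]/norm gi.
Qed.

Lemma Aut_subgroup : is_subgroup (Aut A).
Proof.
split.
- have I1 : integral_mx (1%:M : 'M[K]_n).
    by move=> i j; rewrite mxE; apply: integers_nat.
  by split=> // [|x y]; [exists 1%:M; rewrite mulmx1|rewrite !mul1mx].
- move=> g h [Ig [g' [Ig' gg' g'g]] gi] [Ih [h' [Ih' hh' h'h]] hi]; split.
  + exact: integral_mul.
  + exists (h' *m g'); split; first exact: integral_mul.
      by rewrite -mulmxA (mulmxA h) hh' mul1mx.
    by rewrite -mulmxA (mulmxA g') g'g mul1mx.
  + by move=> x y; rewrite -!mulmxA gi hi.
- move=> g h [Ig [g' [Ig' gg' g'g]] gi] gh hg.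
  have -> : h = g' by rewrite -[h]mul1mx -g'g -mulmxA gh mulmx1.
  split=> //; first by exists g.
  by move=> x y; rewrite -gi !mulmxA gg' !mul1mx.
Qed.

Lemma Reflec_subgroup : is_subgroup (Reflec A).
Proof.
split.
- by move=> S [[S1 _ _] _].
- by move=> g h Wg Wh S SP; have [[_ SM _] _] := SP; apply: SM; [apply: Wg|apply: Wh].
- move=> g h Wg gh hg S SP; have [[_ _ SV] _] := SP.
  by apply: (SV g) => //; apply: Wg.
Qed.

Lemma Reflec_Aut g : Reflec A g -> Aut A g.
Proof. by apply: smallest_sub; [exact: Aut_subgroup|move=> ? []]. Qed.

Lemma Reflec1 : Reflec A 1%:M. Proof. by case: Reflec_subgroup. Qed.

Lemma ReflecM g h : Reflec A g -> Reflec A h -> Reflec A (g *m h).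
Proof. by case: Reflec_subgroup => _ + _; apply. Qed.

Lemma ReflecV g : Reflec A g ->
  exists h, [/\ Reflec A h, g *m h = 1%:M & h *m g = 1%:M].
Proof.
move=> Wg; have [_ [h [_ gh hg]] _] := Reflec_Aut Wg.
by exists h; split=> //; case: Reflec_subgroup => _ _; apply; first exact: Wg.
Qed.

Lemma AutV g : Aut A g -> exists h, [/\ Aut A h, g *m h = 1%:M & h *m g = 1%:M].
Proof.
move=> Ag; have [_ [h [_ gh hg]] _] := Ag.
by exists h; split=> //; case: Aut_subgroup => _ _; apply; first exact: Ag.
Qed.

Lemma AutM g h : Aut A g -> Aut A h -> Aut A (g *m h).
Proof. by case: Aut_subgroup => _ + _; apply. Qed.

Lemma norm_Aut g v : Aut A g -> norm A (g *m v) = norm A v.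
Proof. by case=> _ _ gi; rewrite /norm gi. Qed.

Lemma Aut_lattice g v : Aut A g -> lattice_points R t n v ->
  lattice_points R t n (g *m v).
Proof. by case=> Ig _ _; apply: lattice_mul. Qed.

(** An automorphism h conjugates the reflection in r to the reflection in
h r. *)
Lemma Reflec_normal h h' g : Aut A h -> h *m h' = 1%:M -> h' *m h = 1%:M ->
  Reflec A g -> Reflec A (h *m g *m h').
Proof.
move=> Ah hh' h'h Wg.
have [_ AM AV] := Aut_subgroup.
have Ah' : Aut A h' by exact: AV hh' h'h.
pose S : set 'M[K]_n := [set g | Reflec A (h *m g *m h')].
suff : Reflec A `<=` S by apply.
apply: smallest_sub.
  split; rewrite /S /=.
  - by rewrite mulmx1 hh'; apply: Reflec1.
  - move=> g1 g2 W1 W2; have := ReflecM W1 W2.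
    by rewrite -!mulmxA (mulmxA h') h'h mul1mx !mulmxA.
  - move=> g1 g2 W1 g12 g21.
    have [_ _ V] := Reflec_subgroup; apply: (V _ _ W1).
      by rewrite -!mulmxA (mulmxA h') h'h mul1mx (mulmxA g1) g12 mul1mx.
    by rewrite -!mulmxA (mulmxA h') h'h mul1mx (mulmxA g2) g21 mul1mx.
move=> g1 [Ag1 [r [xi [r0 xi1 xi2 g1E]]]].
apply: sub_gen_smallest; split; first by apply: (AM _ _ _ Ah'); apply: AM.
exists (h *m r), xi; split=> //; first by rewrite norm_Aut.
move=> v; rewrite -!mulmxA g1E reflection_isom ?gt_eqF//; last by case: Ah.
by rewrite mulmxA hh' mul1mx.
Qed.

(** Roots with multipliers whose reflections automatically preserve the
lattice, because (1 - xi) / r^2 is integral. *)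
Definition root_pair r xi :=
  (norm A r = 2 /\ xi = - 1) \/
  [/\ norm A r = 1, O xi, Defs.root_of_unity xi & xi != 1].

Hypothesis integral : forall x y, lattice_points R t n x ->
  lattice_points R t n y -> O <<x, y>>.

Lemma Reflec_root r xi : lattice_points R t n r -> root_pair r xi ->
  exists2 g, Reflec A g & forall v, g *m v = reflection A xi r v.
Proof.
move=> Lr rxi.
have c0 : 0 < norm A r by case: rxi => [[-> _]|[-> _ _ _]]; rewrite ?ltr0n.
have u : Defs.root_of_unity xi.
  by case: rxi => [[_ ->]|[]] //; apply: root_of_unityN1.
have xi1 : xi != 1.
  case: rxi => [[_ ->]|[]] //; apply/eqP => /(congr1 (@realpart R t)).
  rewrite raddfN /= -(rmorph1 (@of_real R t)) re_real; lra.
have lat eta : root_pair r eta -> forall v, lattice_points R t n v ->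
    lattice_points R t n (reflection A eta r v).
  move=> reta v Lv; apply: latticeB => //; apply: latticeZ => //.
  case: reta => [[-> ->]|[-> Oeta _ _]].
    have -> : (1 - -1) * <<r, v>> * of_real t 2^-1 = <<r, v>>.
      rewrite -of_realC mulrA opprK -[1 + 1]/(2%:R : K).
      rewrite -(rmorph_nat (@of_real R t)) -rmorphM mulVf ?pnatr_eq0//.
      by rewrite rmorph1 mul1r.
    exact: integral.
  rewrite invr1 rmorph1 mulr1; apply: integersM; last exact: integral.
  by apply: integersB => //; apply: integers1.
have sxi := root_of_unity_sqn u.
have rxi' : root_pair r (sconj xi).
  case: rxi => [[c2 ->]|[c1 Oxi [m xim] _]]; [left; split=> //|right].
    by rewrite raddfN /= sconj1.
  have cX (k : nat) : sconj (xi ^+ k) = sconj xi ^+ k.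
    by elim: k => [|k IH]; rewrite ?sconj1// exprS exprSr sconjM IH.
  split=> //; first exact: integers_conj.
    by exists m; rewrite -cX xim sconj1.
  by apply: contra_neq xi1 => /(congr1 (@sconj R t)); rewrite sconjK sconj1.
have [g gE] := reflection_mx xi r; have [h hE] := reflection_mx (sconj xi) r.
exists g => //; apply: sub_gen_smallest; split; last by exists r, xi.
split.
- by apply: integral_mx_lattice => v Lv; rewrite gE; apply: lat.
- exists h; split.
  + by apply: integral_mx_lattice => v Lv; rewrite hE; apply: lat.
  + apply: mul_mx_ext => v; rewrite -mulmxA hE gE reflection_comp ?gt_eqF//.
    by rewrite mul_conjC sxi rmorph1 reflection1 mul1mx.
  + apply: mul_mx_ext => v; rewrite -mulmxA gE hE reflection_comp ?gt_eqF//.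
    by rewrite mul_conj sxi rmorph1 reflection1 mul1mx.
- by move=> x y; rewrite !gE pairing_reflection ?gt_eqF.
Qed.

Lemma norm_int v : lattice_points R t n v -> exists z : int, norm A v = z%:~R.
Proof.
move=> Lv; apply: (@integers_real R t).
by rewrite -pairing_norm; apply: integral.
Qed.

End Form.

(** * The hyperbolic lattice and its Heisenberg translations *)

Section Hyperbolic.
Variables (R : realType) (t : ring_kind) (n : nat).
Local Notation K := (scalars R t).
Local Notation O := (@integers R t).
Variable A : 'M[K]_n.
Local Notation L := (orthogonal_sum A (II11 R t)).
Local Notation "<< x , y >>" := (pairing A x y).
Implicit Types (x y l r : 'cV[K]_n) (m a : K) (g h : 'M[K]_(n + 2)).

(** The vector (x; m, a) of the sum with the hyperbolic plane. *)
Definition vec x m a : 'cV[K]_(n + 2) :=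
  col_mx x (\col_(i < 2) (if i == 0 then m else a)).

Definition ht (v : 'cV[K]_(n + 2)) : K := v (rshift n 0) 0.

Lemma ht_vec x m a : ht (vec x m a) = m.
Proof. by rewrite /ht /vec col_mxEd mxE. Qed.

Lemma vec_inj x m a x' m' a' : vec x m a = vec x' m' a' ->
  [/\ x = x', m = m' & a = a'].
Proof.
move/eq_col_mx => [-> E]; split=> //.
  by have /matrixP/(_ 0 0) := E; rewrite !mxE.
by have /matrixP/(_ 1 0) := E; rewrite !mxE.
Qed.

Lemma vec_surj (v : 'cV[K]_(n + 2)) : exists x m a, v = vec x m a.
Proof.
exists (usubmx v), (dsubmx v 0 0), (dsubmx v 1 0).
rewrite -[LHS]vsubmxK; congr col_mx; apply/matrixP => i j.
by rewrite mxE [j]ord1; case: i => -[|[|]] // i; congr (dsubmx v _ _); apply/val_inj.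
Qed.

Lemma vecD x m a x' m' a' :
  vec x m a + vec x' m' a' = vec (x + x') (m + m') (a + a').
Proof.
by rewrite /vec add_col_mx; congr col_mx; apply/matrixP => i j; rewrite !mxE; case: ifP.
Qed.

Lemma vecN x m a : - vec x m a = vec (- x) (- m) (- a).
Proof.
by rewrite /vec opp_col_mx; congr col_mx; apply/matrixP => i j; rewrite !mxE; case: ifP.
Qed.

Lemma vecZ x m a b : rscale (vec x m a) b = vec (rscale x b) (m * b) (a * b).
Proof.
rewrite /vec {1}/rscale mul_col_mx; congr col_mx; apply/matrixP => i j.
by rewrite [LHS]rscaleE !mxE; case: ifP.
Qed.

Lemma lattice_vec x m a : lattice_points R t (n + 2) (vec x m a) <->
  [/\ lattice_points R t n x, O m & O a].
Proof.
split=> [Lv|[Lx Om Oa] i].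
  split=> [i||].
  - by have := Lv (lshift 2 i); rewrite /vec col_mxEu.
  - by have := Lv (rshift n 0); rewrite /vec col_mxEd mxE.
  - by have := Lv (rshift n 1); rewrite /vec col_mxEd mxE.
rewrite -(splitK i); case: (fintype.split i) => j /=.
  by rewrite /vec col_mxEu.
by rewrite /vec col_mxEd mxE; case: ifP.
Qed.

Lemma pairing_vec x m a x' m' a' :
  pairing L (vec x m a) (vec x' m' a') =
  <<x, x'>> + (sconj m * a' + sconj a * m').
Proof.
rewrite /pairing /vec /orthogonal_sum map_col_mx tr_col_mx mul_row_block.
rewrite !mulmx0 add0r addr0 mul_row_col mxE; congr (_ + _).
rewrite mxE big_ord_recl big_ord1 !mxE /= !big_ord_recl !big_ord0 !mxE /=.
by rewrite !mulr0 !mulr1 !addr0 add0r addrC.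
Qed.

(** An isometry of this form is a Heisenberg translation: it is unipotent and
fixes (0; 0, 1).  It carries (0; 1, 0) to (l; 1, b), and it is central in the
Heisenberg group when l = 0. *)
Definition is_trans g l b := forall x m a,
  g *m vec x m a = vec (x + rscale l m) m (a - <<l, x>> + b * m).

Hypothesis herm : forall x y, <<x, y>> = sconj <<y, x>>.
Hypothesis integral : forall x y, lattice_points R t n x ->
  lattice_points R t n y -> O <<x, y>>.

Lemma herm_L v w : pairing L v w = sconj (pairing L w v).
Proof.
have [x [m [a ->]]] := vec_surj v; have [x' [m' [a' ->]]] := vec_surj w.
rewrite !pairing_vec !raddfD /= !sconjM !sconjK -herm; congr (_ + _).
exact: addrC.
Qed.

Lemma integral_L v w : lattice_points R t (n + 2) v ->
  lattice_points R t (n + 2) w -> O (pairing L v w).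
Proof.
have [x [m [a ->]]] := vec_surj v; have [x' [m' [a' ->]]] := vec_surj w.
move=> /lattice_vec[Lx Om Oa] /lattice_vec[Lx' Om' Oa'].
rewrite pairing_vec; apply: integersD; first exact: integral.
by apply: integersD; apply: integersM => //; apply: integers_conj.
Qed.

Lemma norm_vec x m a :
  norm L (vec x m a) = norm A x + 2 * realpart (sconj m * a).
Proof.
rewrite /norm pairing_vec !raddfD /= -[sconj a * m]sconjK re_conj sconjM sconjK.
by rewrite mulr_natl mulr2n.
Qed.

Lemma reflection_vec xi r p q x m a :
  let s := (1 - xi) * (<<r, x>> + (sconj p * a + sconj q * m)) *
           of_real t (norm L (vec r p q))^-1 in
  reflection L xi (vec r p q) (vec x m a) =
  vec (x - rscale r s) (m - p * s) (a - q * s).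
Proof. by rewrite /reflection pairing_vec vecZ vecN vecD. Qed.

Lemma root_pairN1 (k : nat) (B : 'M[K]_k) (r : 'cV_k) : norm B r = 1 \/ norm B r = 2 ->
  root_pair B r (- 1).
Proof.
case=> E; [right|by left]; split=> //.
- exact/integersN/integers1.
- exact: root_of_unityN1.
- apply/eqP => /(congr1 (@realpart R t)).
  by rewrite raddfN /= -(rmorph1 (@of_real R t)) re_real; lra.
Qed.

Lemma trans_comp g h l b l' b' : is_trans g l b -> is_trans h l' b' ->
  is_trans (g *m h) (l + l') (b + b' - <<l, l'>>).
Proof.
move=> gT hT x m a; rewrite -mulmxA hT gT -addrA -rscaleDl; congr vec.
  by rewrite [l' + l]addrC.
rewrite (pairingDr A) (pairingDl herm) (pairingZr A) !mulrDl mulNr !opprD.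
by rewrite !addrA [LHS](ACl (1*4*2*6*3*5)%AC).
Qed.

(** The mirrors of (r; 0, q) and (r; 0, 0) are parallel: they meet only at the
cusp (0; 0, 1), because the two roots agree modulo that vector.
The product of the two biflections is therefore a translation, and
q = - r^2 conj b makes its Lambda-component 2 r b. *)
Lemma trans_root r b : lattice_points R t n r -> norm A r = 1 \/ norm A r = 2 ->
  O b -> exists2 g, Reflec L g & exists c, is_trans g (rscale r (2 * b)) c.
Proof.
move=> Lr rc Ob; set c := norm A r.
have c0 : c != 0 by case: rc => E; rewrite /c E ?oner_eq0 ?pnatr_eq0.
have Oc : O (of_real t c).
  case: rc => E; rewrite /c E ?rmorph1 ?rmorph_nat; first exact: integers1.
  exact: integers_nat.
pose q := - (of_real t c * sconj b).
have Oq : O q by apply/integersN/integersM => //; apply: integers_conj.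
have c1 : norm L (vec r 0 0) = c by rewrite norm_vec mulr0 raddf0 mulr0 addr0.
have c2 : norm L (vec r 0 q) = c.
  by rewrite norm_vec raddf0 mul0r raddf0 mulr0 addr0.
have [g1 W1 g1E] : exists2 g, Reflec L g &
    forall v, g *m v = reflection L (-1) (vec r 0 0) v.
  apply: (Reflec_root herm_L integral_L).
    by apply/lattice_vec; split=> //; apply: integers0.
  by apply: root_pairN1; rewrite c1.
have [g2 W2 g2E] : exists2 g, Reflec L g &
    forall v, g *m v = reflection L (-1) (vec r 0 q) v.
  apply: (Reflec_root herm_L integral_L).
    by apply/lattice_vec; split=> //; apply: integers0.
  by apply: root_pairN1; rewrite c2.
exists (g2 *m g1); first exact: ReflecM.
exists (- (of_real t c * sconj b * (2 * b))) => x m a.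
rewrite -mulmxA g1E reflection_vec c1 g2E reflection_vec c2.
set s1 := _ * _ * of_real t c^-1; set s2 := _ * _ * of_real t c^-1.
have cs1 : of_real t c * s1 = 2 * <<r, x>>.
  rewrite /s1 !raddf0 !mul0r !addr0 opprK of_realC -mulrA -rmorphM mulVf//.
  by rewrite rmorph1 mulr1.
have sq : sconj q = - (of_real t c * b).
  by rewrite /q raddfN /= sconjM sconjK sconj_real -of_realC.
have s1E : s1 = (1 - -1) * <<r, x>> * of_real t c^-1.
  by rewrite /s1 raddf0 !mul0r !addr0.
have s2E : s2 = - s1 - 2 * b * m.
  have -> : s2 = (1 - -1) * (- <<r, x>> - of_real t c * b * m) * of_real t c^-1.
    congr (_ * _ * _); rewrite raddf0 !mul0r add0r subr0 sq (pairingDr A).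
    rewrite (pairingNr A) (pairingZr A) (pairing_norm herm) -/c cs1 mulr_natl.
    by rewrite mulr2n opprD addrA subrr add0r mulNr.
  rewrite s1E mulrDr mulrDl !mulrN !mulNr.
  congr (- _ - _); rewrite opprK -[1 + 1]/(2%:R : K).
  rewrite -(rmorph_nat (@of_real R t)) -of_realC -!mulrA.
  rewrite (mulrA (of_real t 2)) (of_realC 2) -(mulrA _ (of_real t 2)) !mulrA.
  by rewrite -rmorphM mulVf// rmorph1 mul1r.
congr vec.
- rewrite -addrA -opprD -rscaleDr s2E addrA subrr sub0r rscaleNr opprK.
  by rewrite rscaleA.
- by rewrite !mul0r !subr0.
rewrite mul0r subr0 -addrA; congr (_ + _).
rewrite (pairingZl herm) sconjM mulNr opprK s2E mulrBr mulrN.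
rewrite (of_realC c) -!mulrA cs1 !mulrA.
by rewrite mulNr -(rmorph_nat (@of_real R t)) sconj_real.
Qed.

Lemma central_add g h b b' : is_trans g 0 b -> is_trans h 0 b' ->
  is_trans (g *m h) 0 (b + b').
Proof.
by move=> gT hT; have := trans_comp gT hT; rewrite (pairing0r A) subr0 addr0.
Qed.

Lemma central_opp g h b : is_trans g 0 b -> h *m g = 1%:M -> is_trans h 0 (- b).
Proof.
move=> gT hg x m a.
have E : vec x m a = g *m vec x m (a - b * m).
  by rewrite gT (pairing0l herm) /rscale mul0mx addr0 subr0 subrK.
by rewrite E mulmxA hg mul1mx (pairing0l herm) /rscale mul0mx addr0 subr0 mulNr.
Qed.

(** The factor 12 is the exponent that the relations below provide for every
one of the three rings. *)
Definition central (z : K) := exists2 g, Reflec L g & is_trans g 0 (12 * z).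

Lemma centralD z w : central z -> central w -> central (z + w).
Proof.
move=> [g Wg gT] [h Wh hT]; exists (g *m h); first exact: ReflecM.
by rewrite mulrDr; apply: central_add.
Qed.

Lemma centralN z : central z -> central (- z).
Proof.
move=> [g Wg gT]; have [h [Wh gh hg]] := ReflecV Wg.
by exists h => //; rewrite mulrN; apply: central_opp hg.
Qed.

Lemma centralMz z (k : int) : central z -> central (z * k%:~R).
Proof.
move=> cz; have c0 : central (z * 0).
  by rewrite mulr0 -(subrr z); apply: centralD => //; apply: centralN.
have nat (i : nat) : central (z * i%:R).
  elim: i => [|i IH] //; rewrite -natr1 mulrDr mulr1; exact: centralD.
case: k => k; first exact: nat.
by rewrite NegzE mulrNz mulrN; apply/centralN/nat.
Qed.

(** Biflections in the long roots of the hyperbolic plane.  Conjugating by the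
central translation of parameter z turns the flip at 0, which exchanges the two
isotropic coordinates up to sign, into the flip at z. *)
Lemma flip z : O z -> sconj z = - z -> exists2 g, Reflec L g &
  forall x m a, g *m vec x m a = vec x (z * m - a) (- (z * a) - (1 - z * z) * m).
Proof.
move=> Oz zN; have O1 := integers1 R t.
have rz : realpart z = 0.
  by have := congr1 (@realpart R t) zN; rewrite re_conj raddfN /=; lra.
have N2 : norm L (vec 0 1 (1 + z)) = 2.
  rewrite norm_vec (norm0 A) sconj1 mul1r raddfD /= rz.
  by rewrite -(rmorph1 (@of_real R t)) re_real; ring.
have [g Wg gE] : exists2 g, Reflec L g &
    forall v, g *m v = reflection L (-1) (vec 0 1 (1 + z)) v.
  apply: (Reflec_root herm_L integral_L).
    by apply/lattice_vec; split=> //; [apply: lattice0|apply: integersD].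
  by apply: root_pairN1; right.
exists g => // x m a; rewrite gE reflection_vec N2.
set s := _ * _; have -> : s = a + (1 - z) * m.
  rewrite /s (pairing0l herm) add0r sconj1 mul1r raddfD /= sconj1 zN -of_realC.
  rewrite opprK -[1 + 1]/(2%:R : K) -(rmorph_nat (@of_real R t)) mulrA -rmorphM.
  by rewrite mulVf ?pnatr_eq0// rmorph1 mul1r.
congr vec; first by rewrite /rscale mul0mx subr0.
  rewrite mul1r mulrBl mul1r !opprD opprK !addrA [LHS](ACl (1*3*4*2)%AC) /=.
  by rewrite subrr add0r.
have -> : (1 - z * z) * m = (1 - z) * m + z * ((1 - z) * m).
  by rewrite mulrA -mulrDl mulrBr mulr1 addrA subrK.
rewrite mulrDl mul1r mulrDr !opprD !addrA [LHS](ACl (1*2*4*3*5)%AC) /=.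
by rewrite subrr add0r.
Qed.

(** For an imaginary unit u, the flip S at 0 and the translation T of parameter
u generate a group like SL_2(Z), where the cube of T S is central.  As the flip
at j u is the conjugate of S by T^j, the product of the flips at u, 2 u, 3 u is
(T S)^3 T^(-3), a translation up to a central factor.  The intermediate
coordinates are kept as variables so that they can be expanded once the scalars
are concrete. *)
Lemma triple_flip u : O u -> sconj u = - u -> exists2 g, Reflec L g &
  forall x m a, exists m1 a1 m2 a2,
  [/\ g *m vec x m a = vec x (u * m2 - a2) (- (u * a2) - (1 - u * u) * m2),
      m2 = 2 * u * m1 - a1,
      a2 = - (2 * u * a1) - (1 - 2 * u * (2 * u)) * m1,
      m1 = 3 * u * m - a & a1 = - (3 * u * a) - (1 - 3 * u * (3 * u)) * m].
Proof.
move=> Ou uN.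
have fl (k : nat) : exists2 g, Reflec L g & forall x m a, g *m vec x m a =
    vec x (k%:R * u * m - a) (- (k%:R * u * a) - (1 - k%:R * u * (k%:R * u)) * m).
  apply: flip; first by apply: integersM => //; apply: integers_nat.
  by rewrite -(rmorph_nat (@of_real R t)) sconjM sconj_real uN mulNr -of_realC.
have [g1 W1 g1E] := fl 1%N; have [g2 W2 g2E] := fl 2%N; have [g3 W3 g3E] := fl 3%N.
exists (g1 *m (g2 *m g3)); first by do 2!apply: ReflecM => //.
move=> x m a; do 4!eexists; split; last by []; last by []; last by []; last by [].
by rewrite -!mulmxA g3E g2E g1E !mul1r.
Qed.

End Hyperbolic.

(** * Central translations *)

Section Center.
Variables (R : realType) (n : nat).

(** Here g is left multiplication by - u on the two isotropic coordinates,
composed with the central translation of parameter - 3 u.  The two factors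
commute and the first one has order 4. *)
Lemma central_of_triple_flip t (A : 'M[scalars R t]_n) u (g : 'M_(n + 2)) :
  (forall x y, pairing A x y = sconj (pairing A y x)) ->
  u * u = -1 -> Reflec (orthogonal_sum A (II11 R t)) g ->
  (forall x m a, g *m vec x m a = vec x (- (u * m)) (- (u * a) - 3 * m)) ->
  central A u.
Proof.
move=> herm uu Wg gE; rewrite -[u]opprK; apply: centralN => //.
exists (g *m g *m (g *m g)).
  by do 2!apply: ReflecM.
have ux x : u * (u * x) = - x by rewrite mulrA uu mulN1r.
have g2E x m a : g *m g *m vec x m a = vec x (- m) (- a + 6 * (u * m)).
  rewrite -mulmxA !gE !mulrN ux opprK; congr vec.
  have u3 : u * (3 * m) = 3 * (u * m).
    by rewrite !mulrA -(rmorph_nat (@of_real R t)) of_realC.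
  rewrite mulrBr mulrN ux opprK u3 opprB addrC addrA opprK.
  by rewrite -mulrDl -natrD [RHS]addrC.
move=> x m a; rewrite -mulmxA !g2E (pairing0l herm) /rscale mul0mx addr0 subr0.
rewrite opprK; congr vec; rewrite !mulrN opprD opprK -addrA -opprD.
by rewrite -mulrDl -natrD mulNr mulrA.
Qed.

Lemma triple_flip_identity t (u m a : scalars R t) : realpart u = 0 -> u * u = -1 ->
  let m1 := 3 * u * m - a in let a1 := - (3 * u * a) - (1 - 3 * u * (3 * u)) * m in
  let m2 := 2 * u * m1 - a1 in
  let a2 := - (2 * u * a1) - (1 - 2 * u * (2 * u)) * m1 in
  u * m2 - a2 = - (u * m) /\
  - (u * a2) - (1 - u * u) * m2 = - (u * a) - 3 * m.
Proof.
case: t u m a => [[p q] [m0 m1] [a0 a1]|[p q] [m0 m1] [a0 a1]|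
  [p q r s] [m0 m1 m2 m3] [a0 a1 a2 a3]] /= -> -[H _].
- have qq : q ^+ 2 = 1 by rewrite expr2; lra.
  by split; apply: complex_ext => /=; ring : qq.
- have qq : q ^+ 2 = 1 by rewrite expr2; lra.
  by split; apply: complex_ext => /=; ring : qq.
have qq : q ^+ 2 = 1 - r ^+ 2 - s ^+ 2 by rewrite !expr2; lra.
by split; apply: quat_ext => /=; ring : qq.
Qed.

Lemma central_imaginary_unit t (A : 'M[scalars R t]_n) u :
  (forall x y, pairing A x y = sconj (pairing A y x)) ->
  (forall x y, lattice_points R t n x -> lattice_points R t n y ->
    integers (pairing A x y)) ->
  integers u -> realpart u = 0 -> u * u = -1 -> central A u.
Proof.
move=> herm integral Ou u0 uu.
have uN : sconj u = - u.
  by apply/eqP; rewrite -addr_eq0 addrC add_conj u0 mulr0 raddf0.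
have [g Wg gE] := triple_flip herm integral Ou uN.
apply: (central_of_triple_flip herm uu Wg) => x m a.
have [m1 [a1 [m2 [a2 [-> -> -> -> ->]]]]] := gE x m a.
by have [-> ->] := triple_flip_identity m a u0 uu.
Qed.

End Center.

Section Center.
Variables (R : realType) (n : nat).

(** The map f is multiplication by the sixth root of unity c composed with a
central translation, and c^3 = - 1. *)
Lemma eisenstein_cube (c m a : R[i]%C) : c * c = c - 1 ->
  let f (p : R[i]%C * R[i]%C) := (c * p.1, c * p.2 + (c - 2) * p.1) in
  f (f (f (m, a))) = (- m, - a + 3 * (1 - 2 * c) * m).
Proof.
move=> cc /=; have c2 : c ^+ 2 = c - 1 by rewrite expr2.
by congr (_, _); ring : c2.
Qed.

(** No imaginary Eisenstein integer is a unit, so short roots are used here: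
with b a primitive sixth root of unity, the b-reflection in (0; 1, b) followed
by the flip at 0 fixes the cusp (0; 0, 1) up to a unit, and its twelfth power
is a translation. *)
Lemma central_eisenstein (A : 'M[scalars R Eisenstein]_n) :
  (forall x y, pairing A x y = sconj (pairing A y x)) ->
  (forall x y, lattice_points R Eisenstein n x ->
    lattice_points R Eisenstein n y -> integers (pairing A x y)) ->
  central A (intcoord R Eisenstein 1 2 0 0).
Proof.
move=> herm integral; pose b := intcoord R Eisenstein 1 1 0 0.
have s3 : Num.sqrt 3 ^+ 2 = 3 :> R by rewrite sqr_sqrtr.
have bb : b * b = b - 1 by apply: complex_ext => /=; field : s3.
have bcb : b * sconj b = 1 by apply: complex_ext => /=; field : s3.
have cb : 1 - b = sconj b by apply: complex_ext => /=; field.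
have Ob : integers b by apply/integersP; do 4!eexists.
have O1 := integers1 R Eisenstein.
have N1 : norm (orthogonal_sum A (II11 R Eisenstein)) (vec 0 1 b) = 1.
  by rewrite norm_vec (norm0 A) sconj1 mul1r /=; field.
have [g Wg gE] : exists2 g, Reflec (orthogonal_sum A (II11 R Eisenstein)) g &
    forall v, g *m v = reflection (orthogonal_sum A (II11 R Eisenstein)) b (vec 0 1 b) v.
  apply: (Reflec_root (herm_L herm) (integral_L integral)).
    by apply/lattice_vec; split=> //; apply: lattice0.
  right; split=> //.
    exists 5; have b3 : b ^+ 3 = -1.
      by rewrite exprS expr2 bb mulrBr bb mulr1 addrAC subrr add0r.
    by rewrite (exprM b 3 2) b3 sqrrN expr1n.
  apply/eqP => b1; have := cb; rewrite b1 subrr sconj1 => /esym/eqP.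
  by rewrite oner_eq0.
have z0 : sconj 0 = - 0 :> scalars R Eisenstein by rewrite raddf0 oppr0.
have [h Wh hE] := flip herm integral (integers0 R Eisenstein) z0.
pose c := sconj b; have cc : c * c = c - 1.
  by apply: complex_ext => /=; field : s3.
have hgE x m a : h *m g *m vec x m a = vec x (c * m) (c * a + (c - 2) * m).
  rewrite -mulmxA gE reflection_vec N1 hE invr1 rmorph1 mulr1 cb (pairing0l herm).
  rewrite add0r sconj1 mul1r -/c; congr vec; first by rewrite /rscale mul0mx subr0.
    by rewrite mul0r sub0r opprB mulrA bcb !mul1r addrC addKr.
  rewrite !mul0r !oppr0 addr0 add0r !mul1r opprB mulrDr mulrA cc -addrA.
  by congr (_ + _); rewrite -[X in _ - X]mul1r -mulrBl -addrA -opprD.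
have W2 : Reflec (orthogonal_sum A (II11 R Eisenstein)) (h *m g) by apply: ReflecM.
pose f (p : R[i]%C * R[i]%C) := (c * p.1, c * p.2 + (c - 2) * p.1).
move: (h *m g) W2 hgE => q Wq qE; pose q3 := q *m (q *m q).
have fE x p : q *m vec x p.1 p.2 = vec x (f p).1 (f p).2 by rewrite qE.
have W3 : Reflec (orthogonal_sum A (II11 R Eisenstein)) q3 by do 2?apply: ReflecM.
have q3E x m a : q3 *m vec x m a = vec x (- m) (- a + 3 * (1 - 2 * c) * m).
  have q1 : q *m vec x m a = vec x (f (m, a)).1 (f (m, a)).2 by rewrite qE.
  have f3 : f (f (f (m, a))) = (- m, - a + 3 * (1 - 2 * c) * m).
    exact: eisenstein_cube.
  by rewrite /q3 -!mulmxA q1 !fE f3.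
move: q3 W3 q3E => {fE qE} {}q {}Wq qE.
have tE : 1 - 2 * c = intcoord R Eisenstein 1 2 0 0.
  by apply: complex_ext => /=; field.
rewrite tE in qE; set z := intcoord _ _ _ _ _ _ in qE *.
rewrite -[z]opprK; apply: centralN => //; exists (q *m q *m (q *m q)).
  by do 6?apply: ReflecM.
have q6E x m a : q *m q *m vec x m a = vec x m (a + 6 * - z * m).
  rewrite -mulmxA !qE opprK; congr vec; rewrite mulrN opprD opprK -addrA.
  by rewrite -opprD -mulrDl -mulrDl -natrD mulrN mulNr.
move=> x m a; rewrite -mulmxA !q6E (pairing0l herm) /rscale mul0mx addr0 subr0.
by congr vec; rewrite -addrA -mulrDl -mulrDl -natrD.
Qed.

(** The imaginary integers are spanned over Z by i, by sqrt(-3) = 1 + 2 omega,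
and by i, j, k respectively. *)
Lemma central_imaginary t (A : 'M[scalars R t]_n) z :
  (forall x y, pairing A x y = sconj (pairing A y x)) ->
  (forall x y, lattice_points R t n x ->
    lattice_points R t n y -> integers (pairing A x y)) ->
  integers z -> realpart z = 0 -> central A z.
Proof.
case: t A z => A z herm integral /integersP[a [b [c [d ->]]]] re0.
- have -> : intcoord R Gaussian a b c d = intcoord R Gaussian 0 1 0 0 * b%:~R.
    rewrite -(of_real_int _ Gaussian); apply: complex_ext => /=; last by ring.
    by rewrite -[LHS]/(realpart (intcoord R Gaussian a b c d)) re0 /=; ring.
  apply: centralMz => //; apply: central_imaginary_unit => //.
    by apply/integersP; do 4!eexists.
  by apply: complex_ext => /=; ring.
- have bE : b%:~R = 2 * a%:~R :> R by move: re0 => /=; lra.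
  have -> : intcoord R Eisenstein a b c d = intcoord R Eisenstein 1 2 0 0 * a%:~R.
    by rewrite -(of_real_int _ Eisenstein); apply: complex_ext; rewrite /= bE; field.
  by apply: centralMz => //; apply: central_eisenstein.
have a0 : a%:~R = 0 :> R by move: re0 => /=; lra.
have -> : intcoord R Hurwitz a b c d = intcoord R Hurwitz 0 1 0 0 * b%:~R +
    (intcoord R Hurwitz 0 0 1 0 * c%:~R + intcoord R Hurwitz 0 0 0 1 * d%:~R).
  rewrite -3!(of_real_int _ Hurwitz); apply: quat_ext; rewrite /= a0; ring.
have unit b' c' d' : b' * b' + c' * c' + d' * d' = 1 ->
    central A (intcoord R Hurwitz 0 b' c' d').
  move=> H; have HR : b'%:~R * b'%:~R + c'%:~R * c'%:~R + d'%:~R * d'%:~R = 1 :> R.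
    by rewrite -!intrM -!intrD H.
  apply: central_imaginary_unit => //.
  + by apply/integersP; do 4!eexists.
  + by rewrite /= mul0r.
  + by apply: quat_ext => /=; rewrite ?mul0r; lra.
by do 2?apply: centralD => //; apply: centralMz => //; apply: unit.
Qed.

End Center.

(** * Finiteness from invariants *)

Section FiniteSets.

(** The invariant is a relation rather than a function: an element may be
normalized, in a way that involves choices, before its invariant is read
off. *)
Lemma finite_representatives (T I : Type) (G : set T) (F : set I) (Inv : T -> I -> Prop) :
  finite_set F -> (forall g, G g -> exists2 i, F i & Inv g i) ->
  exists S : set T, [/\ finite_set S, S `<=` G &
    forall g, G g -> exists s i, [/\ S s, Inv s i & Inv g i]].
Proof.
move=> finF GF.
have [[g0 Gg0]|G0] := pselect (exists g, G g); last first.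
  by exists set0; split=> // g Gg; case: G0; exists g.
have /choice[f fP] (i : I) : exists s : T, (exists2 g, G g & Inv g i) ->
    G s /\ Inv s i.
  have [[g Gg gi]|Ni] := pselect (exists2 g, G g & Inv g i).
    by exists g.
  by exists g0.
exists (f @` (F `&` [set i | exists2 g, G g & Inv g i])); split.
- by apply: finite_image; apply: finite_setIl.
- by move=> _ [i [_ /fP[]] ? _ <-].
move=> g Gg; have [i Fi gi] := GF g Gg.
have Ei : exists2 g, G g & Inv g i by exists g.
by exists (f i), i; split=> //; [exists i|case: (fP i Ei)].
Qed.

Lemma finite_of_invariant (T I : Type) (G : set T) (F : set I)
    (Inv : T -> I -> Prop) :
  finite_set F -> (forall g, G g -> exists2 i, F i & Inv g i) ->
  (forall g h i, G g -> G h -> Inv g i -> Inv h i -> g = h) -> finite_set G.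
Proof.
move=> finF GF inj; have [S [finS SG GS]] := finite_representatives finF GF.
apply: sub_finite_set finS => g Gg; have [s [i [Ss si gi]]] := GS g Gg.
by rewrite (inj g s i) //; apply: SG.
Qed.

Lemma repeated_value (T : Type) (F : set T) (f : nat -> T) :
  finite_set F -> (forall j, F (f j)) -> exists i j, (i < j)%N /\ f i = f j.
Proof.
move=> finF fF.
have [S [finS _ fS]] := @finite_representatives nat T setT F (fun j x => f j = x) finF
  (fun j _ => ex_intro2 _ _ (f j) (fF j) erefl).
have /finite_seqP[s SE] := finS.
have [i [x [Si <- Ej]]] := fS (\sum_(k <- s) k).+1 I.
exists i, (\sum_(k <- s) k).+1; split=> //.
by move: Si; rewrite SE /= => si; rewrite ltnS (big_rem i) //= leq_addr.
Qed.

Lemma finite_subsets (T : choiceType) (F : set T) :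
  finite_set F -> finite_set [set X : set T | X `<=` F].
Proof.
move=> /finite_seqP[s ->].
apply: (@finite_of_invariant _ {ffun 'I_(size s) -> bool} _ setT
  (fun X f => forall i, X (tnth (in_tuple s) i) <-> f i)).
- exact: finite_finset.
- by move=> X _; exists [ffun i => `[< X (tnth (in_tuple s) i) >]] => // i;
    rewrite ffunE; apply: (rwP (asboolP _)).
move=> X Y f Xs Ys Xf Yf; apply/seteqP; split=> x Zx.
  have /(nthP x)[i si xi] := Xs x Zx; have := Xf (Ordinal si).
  by rewrite (tnth_nth x) /= xi => E; move/E: Zx => /Yf; rewrite (tnth_nth x) /= xi.
have /(nthP x)[i si xi] := Ys x Zx; have := Yf (Ordinal si).
by rewrite (tnth_nth x) /= xi => E; move/E: Zx => /Xf; rewrite (tnth_nth x) /= xi.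
Qed.

Lemma finite_matrices (T : choiceType) p q (F : 'I_p -> 'I_q -> set T) :
  (forall i j, finite_set (F i j)) ->
  finite_set [set g : 'M[T]_(p, q) | forall i j, F i j (g i j)].
Proof.
move=> finF.
have fin (ij : 'I_p * 'I_q) : exists s : seq T, F ij.1 ij.2 = [set` s].
  exact/finite_seqP/finF.
have [s sE] := choice fin.
pose N := \max_ij size (s ij).
apply: (@finite_of_invariant _ {ffun 'I_p * 'I_q -> 'I_N} _ setT
  (fun (g : 'M[T]_(p, q)) f => forall i j, index (g i j) (s (i, j)) = f (i, j))).
- exact: finite_finset.
- move=> g gF; have H ij : (index (g ij.1 ij.2) (s ij) < N)%N.
    have := gF ij.1 ij.2; rewrite sE /= -index_mem => /leq_trans; apply.
    exact: (leq_bigmax ij).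
  by exists [ffun ij => Ordinal (H ij)] => // i j; rewrite ffunE.
move=> g h f gF hF gf hf; apply/matrixP => i j.
have := gF i j; have := hF i j; rewrite (sE (i, j)) /= => hs gs.
by rewrite -(nth_index (g i j) gs) -(nth_index (g i j) hs) gf hf.
Qed.

End FiniteSets.

(** * Discreteness and covering of the positive-definite lattice *)

Section Lattice.
Variables (R : realType) (t : ring_kind) (n : nat).
Local Notation K := (scalars R t).
Local Notation O := (@integers R t).
Local Notation Lam := (lattice_points R t n).
Variable A : 'M[K]_n.
Local Notation "<< x , y >>" := (pairing A x y).
Local Notation L := (orthogonal_sum A (II11 R t)).

Lemma lattice_mod M : (0 < M)%N -> exists F : set 'cV[K]_n,
  [/\ finite_set F, F `<=` Lam & forall l, Lam l ->
      exists f k, [/\ F f, Lam k & l = f + rscale k M%:R]].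
Proof.
move=> M0; have [F [finF FO FP]] := integers_mod R t M0.
exists [set g | forall i j, F (g i j)]; split.
- exact: (@finite_matrices K n 1 (fun _ _ => F)).
- by move=> f Ff i; apply: FO.
move=> l Ll.
have ch (i : 'I_n) : exists fq : K * K,
    [/\ F fq.1, O fq.2 & l i 0 = fq.1 + fq.2 * M%:R].
  by have [f [q [Ff Oq E]]] := FP _ (Ll i); exists (f, q).
have [fq fqE] := choice ch.
exists (\col_i (fq i).1), (\col_i (fq i).2); split.
- by move=> i j; rewrite mxE; case: (fqE i).
- by move=> i; rewrite mxE; case: (fqE i).
apply/matrixP => i j; rewrite [j]ord1 mxE rscaleE !mxE.
by case: (fqE i).
Qed.

Hypothesis herm : forall x y, <<x, y>> = sconj <<y, x>>.
Hypothesis integral : forall x y, Lam x -> Lam y -> O <<x, y>>.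
Hypothesis pos : Defs.positive_definite A.

Lemma norm_ge0 x : 0 <= norm A x.
Proof.
have [->|/pos/ltW//] := eqVneq x 0.
by rewrite (norm0 A).
Qed.

Lemma norm_eq0 x : norm A x = 0 -> x = 0.
Proof. by move=> x0; apply/eqP/negPn/negP => /pos; rewrite x0 ltxx. Qed.

Lemma norm_parallelogram x y : norm A (x - y) <= 2 * norm A x + 2 * norm A y.
Proof. by have := norm_ge0 (x + y); rewrite (normD herm) (normB herm); lra. Qed.

Lemma norm_nat x : Lam x -> exists k : nat, norm A x = k%:R.
Proof.
move=> Lx; have [[k|k] E] := norm_int herm integral Lx; first by exists k.
by have := norm_ge0 x; rewrite E ler0z.
Qed.

(** Two vectors of the ball that agree modulo M differ by M times a lattice
vector, of norm at most 4 C / M^2 < 1; as norms are integers, they are equal.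
So reduction modulo M is injective on the ball. *)
Lemma finite_ball C : finite_set [set l | Lam l /\ norm A l <= C].
Proof.
pose M := (Num.truncn (4 * C)).+1.
have M0 : (0 < M)%N by [].
have MC : 4 * C < M%:R by rewrite real_truncnS_gt ?num_real.
have [F [finF FL FP]] := lattice_mod M0.
apply: (@finite_of_invariant _ _ _ F
  (fun l f => exists2 k, Lam k & l = f + rscale k M%:R)) => //.
  by move=> l [Ll _]; have [f [k [Ff Lk E]]] := FP l Ll; exists f => //; exists k.
move=> l l' f [Ll lC] [Ll' lC'] [k Lk E] [k' Lk' E'].
have D : l - l' = rscale (k - k') M%:R.
  by rewrite E E' rscaleDl rscaleNl opprD addrACA subrr add0r.
have [i iE] := norm_nat (latticeB Lk Lk').
have := norm_parallelogram l l'.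
rewrite D (normZ herm) -(rmorph_nat (@of_real R t)) sqn_real iE => H.
have i0 : i = 0%N.
  case: i {iE} H => // i H; exfalso.
  have : (1 : R) <= i.+1%:R by rewrite ler1n.
  have : (1 : R) <= M%:R by rewrite ler1n.
  rewrite expr2 in H; nra.
rewrite i0 in iE; have /eqP := norm_eq0 iE; rewrite subr_eq0 => /eqP kk.
by rewrite E E' kk.
Qed.

Lemma covering_lt1 : (covering_radius A < 1)%E ->
  forall x, exists2 l, Lam l & norm A (x - l) < 1.
Proof.
move=> cov x.
have : (ereal_inf [set (Num.sqrt (norm A (x - l)))%:E | l in Lam] < 1)%E.
  by apply: le_lt_trans cov; apply: ereal_sup_ubound; exists x.
move=> /ereal_inf_lt[_ [l Ll <-]]; rewrite lte_fin => H; exists l => //.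
have -> : norm A (x - l) = Num.sqrt (norm A (x - l)) ^+ 2.
  by rewrite sqr_sqrtr // norm_ge0.
by rewrite expr_lt1 // sqrtr_ge0.
Qed.

Lemma covering_le1 : (covering_radius A <= 1)%E ->
  forall x (e : R), 0 < e -> exists2 l, Lam l & norm A (x - l) < 1 + e.
Proof.
move=> cov x e e0.
have : (ereal_inf [set (Num.sqrt (norm A (x - l)))%:E | l in Lam] < (Num.sqrt (1 + e))%:E)%E.
  apply: (@le_lt_trans _ _ 1%E); last first.
    by rewrite lte_fin -{1}[1]sqrtr1 ltr_sqrt; lra.
  by apply: le_trans cov; apply: ereal_sup_ubound; exists x.
move=> /ereal_inf_lt[_ [l Ll <-]]; rewrite lte_fin => H; exists l => //.
by move: H; rewrite ltr_sqrt //; lra.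
Qed.

Lemma root_span_submodule : is_submodule (root_span A).
Proof.
split.
- by move=> S [[]].
- by move=> v w Sv Sw S SP; have [[_ SD _] _] := SP; apply: SD; [apply: Sv|apply: Sw].
- by move=> v a Sv Oa S SP; have [[_ _ SZ] _] := SP; apply: SZ => //; apply: Sv.
Qed.

(** By the pigeonhole principle some multiple of each basis vector is in the
root span; the product of the multipliers works for the whole lattice. *)
Lemma root_span_exponent :
  Defs.finite_index +%R Lam (root_span A) ->
  exists2 k, (0 < k)%N & forall l, Lam l -> root_span A (rscale l k%:R).
Proof.
move=> fin; have [S0 SD SZ] := root_span_submodule.
have Onat k : O k%:R := integers_nat R t k.
have one l : Lam l -> exists2 k, (0 < k)%N & root_span A (rscale l k%:R).
  move=> Ll.
  have [j|i [j [ij E]]] := @repeated_value _ _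
      (fun j => [set rscale l j%:R + h | h in root_span A]) fin.
    by exists (rscale l j%:R) => //; apply: latticeZ.
  have : [set rscale l j%:R + h | h in root_span A] (rscale l j%:R).
    by exists 0 => //; rewrite addr0.
  rewrite -E => -[h Sh hE]; exists (j - i)%N; first by rewrite subn_gt0.
  rewrite natrB 1?ltnW// rscaleDr rscaleNr -hE.
  by rewrite addrC addKr.
have /choice[k kE] (i : 'I_n) : exists k, (0 < k)%N /\
    root_span A (rscale (std R t i) k%:R).
  by have [k] := one _ (@lattice_std R t n i); exists k.
exists (\prod_i k i)%N; first by rewrite prodn_gt0 // => i; case: (kE i).
move=> l Ll; set N := \prod_i k i.
have -> : rscale l N%:R = \sum_i rscale (rscale (std R t i) (l i 0)) N%:R.
  by rewrite {1}[l]cV_sum_std /rscale mulmx_suml.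
apply: (big_ind (root_span A)) => // i _; rewrite /N.
have -> : rscale (rscale (std R t i) (l i 0)) (\prod_i k i)%:R =
  rscale (rscale (std R t i) (k i)%:R) (l i 0 * (\prod_(j | j != i) k j)%:R).
  rewrite !rscaleA; congr rscale; rewrite (bigD1 i) //= natrM !mulrA.
  by congr (_ * _); rewrite -(rmorph_nat (@of_real R t) (k i)) of_realC.
by apply: SZ; [case: (kE i)|apply: integersM].
Qed.

(** The vectors v such that translation by v (2 b) is realized for every integer
b form a submodule containing the roots, hence containing the root span, which
contains a multiple of the lattice. *)
Lemma lattice_translations :
  Defs.finite_index +%R Lam (root_span A) ->
  exists2 k, (0 < k)%N & forall l, Lam l ->
    exists2 g, Reflec L g & exists c, is_trans A g (rscale l k%:R) c.
Proof.
move=> /root_span_exponent[k k0 kP].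
pose M : set 'cV[K]_n := [set v | forall b, O b ->
  exists2 g, Reflec L g & exists c, is_trans A g (rscale v (2 * b)) c].
have RM : root_span A `<=` M.
  apply: smallest_sub; last by move=> r [Lr rr] b Ob; apply: trans_root.
  split.
  - move=> b Ob; exists 1%:M; first exact: Reflec1.
    exists 0 => x m a; rewrite mul1mx /rscale !mul0mx addr0 (pairing0l herm).
    by rewrite subr0 mul0r addr0.
  - move=> v w Mv Mw b Ob; have [g Wg [c gT]] := Mv b Ob.
    have [h Wh [d hT]] := Mw b Ob; exists (g *m h); first exact: ReflecM.
    by rewrite rscaleDl; eexists; apply: trans_comp.
  move=> v a Mv Oa b Ob; have [g Wg [c gT]] := Mv _ (integersM Oa Ob).
  exists g => //; exists c; rewrite rscaleA mulrA.
  by rewrite -(rmorph_nat (@of_real R t)) -of_realC -mulrA rmorph_nat.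
exists (2 * k)%N; first by rewrite muln_gt0.
move=> l /kP/RM/(_ 1 (integers1 R t))[g Wg [c gT]]; exists g => //; exists c.
by move: gT; rewrite rscaleA mulr1 -natrM mulnC.
Qed.

End Lattice.

(** * Reduction of the height of an isotropic vector *)

Section Reduction.
Variables (R : realType) (t : ring_kind) (n : nat).
Local Notation K := (scalars R t).
Local Notation O := (@integers R t).
Local Notation Lam := (lattice_points R t n).
Variable A : 'M[K]_n.
Local Notation "<< x , y >>" := (pairing A x y).
Local Notation L := (orthogonal_sum A (II11 R t)).
Hypothesis herm : forall x y, <<x, y>> = sconj <<y, x>>.
Hypothesis integral : forall x y, Lam x -> Lam y -> O <<x, y>>.
Hypothesis pos : Defs.positive_definite A.

Lemma isotropic_re x m a : Defs.isotropic L (vec x m a) ->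
  2 * realpart (sconj m * a) = - norm A x.
Proof. by rewrite /isotropic norm_vec => /eqP; rewrite addrC addr_eq0 => /eqP. Qed.

Lemma ht_scale (v : 'cV[K]_(n + 2)) a : ht (rscale v a) = ht v * a.
Proof. by rewrite /ht rscaleE. Qed.

Lemma lattice_ht (v : 'cV[K]_(n + 2)) : lattice_points R t (n + 2) v -> O (ht v).
Proof. by apply. Qed.

Lemma isotropic_scale v a : Defs.isotropic L v -> Defs.isotropic L (rscale v a).
Proof. by rewrite /isotropic (normZ (herm_L herm)) => ->; rewrite mul0r. Qed.

Lemma isotropic_Reflec g v : Reflec L g -> Defs.isotropic L v ->
  Defs.isotropic L (g *m v).
Proof.
by move=> /Reflec_Aut Ag; rewrite /isotropic norm_Aut.
Qed.

Lemma reduce_ht x y l : Defs.isotropic L (vec x 1 y) -> Lam l ->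
  norm A (x - l) <= 1 ->
  norm A (x - l) < 1 \/ ~ O (y + <<l, x>> + (y + <<l, x>>)) ->
  exists2 g, Reflec L g & sqn (ht (g *m vec x 1 y)) < 1.
Proof.
move=> /isotropic_re; rewrite sconj1 mul1r => yx Ll.
have [N NE] := norm_int herm integral Ll.
set s := y + <<l, x>>.
have -> : norm A (x - l) = N%:~R - 2 * realpart s.
  by rewrite (normB herm) NE /s raddfD /= (re_pairingC herm l); lra.
move=> D1 D2; have D0 : 0 <= N%:~R - 2 * realpart s.
  have := norm_ge0 pos (x - l).
  by rewrite (normB herm) NE /s raddfD /= (re_pairingC herm l); lra.
have [c [b [xi [Ob bE cxi lt1]]]] := reducing_root_exists D0 D1 D2.
have cE : norm L (vec l 1 b) = c.
  by rewrite norm_vec sconj1 mul1r NE; lra.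
have [g Wg gE] : exists2 g, Reflec L g &
    forall v, g *m v = reflection L xi (vec l 1 b) v.
  apply: (Reflec_root (herm_L herm) (integral_L integral)).
    by apply/lattice_vec; split=> //; apply: integers1.
  by rewrite /root_pair cE; case: cxi => [[-> ->]|[-> ? ? ?]]; [left|right].
exists g => //; rewrite gE reflection_vec ht_vec cE mul1r sconj1 mul1r mulr1.
by rewrite (addrA <<l, x>>) (addrC <<l, x>> y).
Qed.

Lemma minimal_ht v : lattice_points R t (n + 2) v ->
  exists2 w, Reflec L w & forall w', Reflec L w' ->
    sqn (ht (w *m v)) <= sqn (ht (w' *m v)).
Proof.
move=> Lv.
have natw w : Reflec L w -> exists k : nat, sqn (ht (w *m v)) = k%:R.
  move=> /Reflec_Aut Aw; apply: sqn_nat.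
  exact/lattice_ht/(Aut_lattice Aw).
have ex : exists k : nat, `[< exists2 w, Reflec L w & sqn (ht (w *m v)) = k%:R >].
  have [k kE] := natw _ (@Reflec1 _ _ _ L); exists k; apply/asboolP.
  by exists 1%:M => //; apply: Reflec1.
have [k /asboolP[w Ww wE] kmin] := ex_minnP ex.
exists w => // w' Ww'; have [k' k'E] := natw _ Ww'.
by rewrite wE k'E ler_nat; apply: kmin; apply/asboolP; exists w'.
Qed.

(** A vector at which the descent on heights under Reflec L stops. *)
Definition minimal v := forall w, Reflec L w -> sqn (ht v) <= sqn (ht (w *m v)).

Lemma minimal_orbit v : lattice_points R t (n + 2) v ->
  exists2 w, Reflec L w & minimal (w *m v).
Proof.
move=> /minimal_ht[w Ww wmin]; exists w => // w' Ww'.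
by rewrite mulmxA; apply: wmin; apply: ReflecM.
Qed.

(** Where the descent stops, every lattice point within distance 1 of x is at
distance exactly 1, and rounding leaves only the case in which y + <l|x> is half
integral. *)
Lemma minimal_far x y m l : m != 0 -> minimal (rscale (vec x 1 y) m) ->
  Defs.isotropic L (vec x 1 y) -> Lam l -> norm A (x - l) <= 1 ->
  norm A (x - l) = 1 /\ O (y + <<l, x>> + (y + <<l, x>>)).
Proof.
move=> m0 vmin iso Ll D1.
have nred : ~ (norm A (x - l) < 1 \/ ~ O (y + <<l, x>> + (y + <<l, x>>))).
  move=> /(reduce_ht iso Ll D1)[g Wg gl].
  have := vmin g Wg; rewrite rscale_mul !ht_scale ht_vec !sqnM sqn1 mul1r.
  have := sqn_gt0 m; rewrite m0 => m0'.
  by rewrite leNgt gtr_pMl // gl.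
split; last by have [//|NO] := pselect (O (y + <<l, x>> + (y + <<l, x>>)));
  case: nred; right.
apply/eqP; rewrite eq_le D1 leNgt; apply/negP => lt1.
by apply: nred; left.
Qed.

Lemma normalize (x : 'cV[K]_n) m a : m != 0 ->
  vec x m a = rscale (vec (rscale x (sinv m)) 1 (a * sinv m)) m.
Proof.
by move=> m0; rewrite vecZ rscaleA mul1r -mulrA mulVs // rscale1 mulr1.
Qed.

Lemma isotropic_ht0 (x : 'cV[K]_n) a : Defs.isotropic L (vec x 0 a) -> x = 0.
Proof.
move=> /isotropic_re; rewrite raddf0 mul0r raddf0 mulr0 => /esym/eqP.
by rewrite oppr_eq0 => /eqP; apply: (norm_eq0 pos).
Qed.

Definition rho : 'cV[K]_(n + 2) := vec 0 0 1.

Lemma rho_scale a : rscale rho a = vec 0 0 a.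
Proof. by rewrite /rho vecZ /rscale mul0mx mul0r mul1r. Qed.

Lemma lattice_rho : lattice_points R t (n + 2) rho.
Proof.
apply/lattice_vec; split; [exact: lattice0|exact: integers0|exact: integers1].
Qed.

Lemma isotropic_rho : Defs.isotropic L rho.
Proof. by rewrite /isotropic norm_vec (norm0 A) mulr1 raddf0 raddf0 mulr0 addr0. Qed.

(** Since some lattice point is at distance less than 1 from x, the descent
cannot stop at a nonzero height. *)
Lemma transitive_rho v : (covering_radius A < 1)%E ->
  Defs.primitive v -> Defs.isotropic L v ->
  exists w a, [/\ Reflec L w, Defs.is_unit a & w *m v = rscale rho a].
Proof.
move=> cov [Lv v0 vprim] iso.
have [w Ww wmin] := minimal_orbit Lv.
have iso' := isotropic_Reflec Ww iso.
have [x [m [a wE]]] := vec_surj (w *m v).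
have m0 : m = 0.
  apply/eqP/negPn/negP => m0.
  move: wmin iso'; rewrite wE => wmin iso'.
  have isoV : Defs.isotropic L (vec (rscale x (sinv m)) 1 (a * sinv m)).
    by rewrite -(mulsV m0) -vecZ; apply: isotropic_scale.
  rewrite (normalize _ _ m0) in wmin.
  have [l Ll lt1] := covering_lt1 pos cov (rscale x (sinv m)).
  by have [E _] := minimal_far m0 wmin isoV Ll (ltW lt1); rewrite E ltxx in lt1.
move: iso'; rewrite wE m0 => /isotropic_ht0 x0.
have wa : w *m v = rscale rho a by rewrite wE x0 m0 rho_scale.
exists w, a; split=> //.
have [w' [Ww' ww' w'w]] := ReflecV Ww.
have Lw := Aut_lattice (Reflec_Aut Ww) Lv.
apply: (vprim (w' *m rho)).
- exact: Aut_lattice (Reflec_Aut Ww') lattice_rho.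
- by move: Lw; rewrite wa rho_scale => /lattice_vec[].
- by rewrite -rscale_mul -wa mulmxA w'w mul1mx.
Qed.

Lemma unit_mul (a b : K) : Defs.is_unit a -> Defs.is_unit b -> Defs.is_unit (a * b).
Proof.
move=> [Oa [a' [Oa' aa' a'a]]] [Ob [b' [Ob' bb' b'b]]].
split; first exact: integersM.
exists (b' * a'); split; first exact: integersM.
  by rewrite mulrA -(mulrA a) bb' mulr1.
by rewrite mulrA -(mulrA b') a'a mulr1.
Qed.

Lemma transitive_isotropic v w : (covering_radius A < 1)%E ->
  Defs.primitive v -> Defs.isotropic L v ->
  Defs.primitive w -> Defs.isotropic L w ->
  exists g a, [/\ Reflec L g, Defs.is_unit a & g *m v = rscale w a].
Proof.
move=> cov pv iv pw iw.
have [g [a [Wg ua gE]]] := transitive_rho cov pv iv.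
have [h [b [Wh ub hE]]] := transitive_rho cov pw iw.
have [h' [Wh' hh' h'h]] := ReflecV Wh.
have [Ob [b' [Ob' bb' b'b]]] := ub.
exists (h' *m g), (b' * a); split; first exact: ReflecM.
  by apply: unit_mul => //; split=> //; exists b.
have -> : w = h' *m rscale rho b by rewrite -hE mulmxA h'h mul1mx.
by rewrite -mulmxA gE !rscale_mul rscaleA mulrA bb' mul1r.
Qed.

End Reduction.

(** * Deep holes *)

Lemma sqn_parallelogram (R : realType) t (a b : scalars R t) :
  sqn (a - b) <= 2 * sqn a + 2 * sqn b.
Proof.
have := sqn_ge0 (a + b); rewrite /sqn.
by case: t a b => [[??] [??]|[??] [??]|[????] [????]] /=; lra.
Qed.

Section Rigidity.
Variables (R : realType) (t : ring_kind) (n : nat).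
Local Notation K := (scalars R t).
Local Notation O := (@integers R t).
Local Notation Lam := (lattice_points R t n).
Variable A : 'M[K]_n.
Local Notation "<< x , y >>" := (pairing A x y).
Local Notation L := (orthogonal_sum A (II11 R t)).
Hypothesis herm : forall x y, <<x, y>> = sconj <<y, x>>.
Hypothesis integral : forall x y, Lam x -> Lam y -> O <<x, y>>.
Hypothesis pos : Defs.positive_definite A.
Hypothesis cov : (covering_radius A <= 1)%E.

(** If x' differs from x, moving x slightly in the direction of x - x'
increases its distance to every point at distance 1, because those points are
equidistant from x and x'; by the gap the other points remain at distance more
than 1 too.  The new point is then too far from the lattice. *)
Lemma deep_hole_rigid x x' (e : R) : 0 < e ->
  (forall l, Lam l -> norm A (x - l) = 1 \/ 1 + e <= norm A (x - l)) ->
  (forall l, Lam l -> norm A (x - l) = 1 -> norm A (x' - l) = 1) ->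
  x = x'.
Proof.
move=> e0 gap near; apply/esym/eqP; rewrite -subr_eq0; apply/negPn/negP => u0.
set u := x' - x in u0; pose U := norm A u; have U0 : 0 < U := pos u0.
(* The step length: moving x by d u costs the points outside the unit sphere
   at most d (1 + e + U) = e / 2 of their margin e. *)
pose d := e / (2 * (1 + e + U)).
have den : 0 < 2 * (1 + e + U) by lra.
have dE : d * (2 * (1 + e + U)) = e by rewrite divfK // gt_eqF.
have d0 : 0 < d by rewrite divr_gt0.
pose del := Num.min (d * U) (e / 2).
have del0 : 0 < del by rewrite lt_min mulr_gt0 //= divr_gt0.
have [l Ll] := covering_le1 cov (x - rscale u (of_real t d)) del0.
have -> : x - rscale u (of_real t d) - l = (x - l) - rscale u (of_real t d).
  by rewrite addrAC.
rewrite (normB herm) (pairingZr A) -of_realC re_realM (normZ herm) sqn_real.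
rewrite -/U; set p := realpart _ => lt.
have [D1|D2] := gap l Ll.
  have := near l Ll D1; have -> : x' - l = (x - l) + u.
    by rewrite /u [RHS]addrC addrA subrK.
  rewrite (normD herm) -/p -/U D1 => pE.
  have delU : del <= d * U by rewrite ge_min lexx.
  have : 0 <= U * d ^+ 2 by rewrite mulr_ge0 ?sqr_ge0 // ltW.
  have : d * (2 * p) = d * (- U) by congr (_ * _); lra.
  rewrite D1 in lt; lra.
have := norm_ge0 pos ((x - l) - u); rewrite (normB herm) -/p -/U => pU.
have dele : del <= e / 2 by rewrite ge_min lexx orbT.
have : 0 <= U * d ^+ 2 by rewrite mulr_ge0 ?sqr_ge0 // ltW.
move: lt D2 pU; set D := norm A (x - l) => lt D2 pU sq.
have dp : d * (2 * p) <= d * (D + U) by rewrite ler_pM2l //; lra.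
have d1 : d <= 1 / 2 by nra.
have : (1 - d) * (1 + e) <= (1 - d) * D by rewrite ler_pM2l //; lra.
nra.
Qed.

(** A point of the form v m^-1, with v in the lattice, has its squared
distances to lattice points in (1 / |m|^2) Z.  This replaces a compactness
argument in the next two lemmas. *)
Lemma rational_gap x m : O m -> m != 0 -> Lam (rscale x m) ->
  forall l, Lam l -> exists k : nat, norm A (x - l) * sqn m = k%:R.
Proof.
move=> Om m0 Lx l Ll; rewrite -(normZ herm) rscaleDl rscaleNl.
by apply: norm_nat => //; apply: latticeB => //; apply: latticeZ.
Qed.

Lemma near_point x m : O m -> m != 0 -> Lam (rscale x m) ->
  exists2 l, Lam l & norm A (x - l) <= 1.
Proof.
move=> Om m0 Lx; have s0 : 0 < sqn m by rewrite sqn_gt0.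
have [l Ll lt] := covering_le1 cov x (divr_gt0 ltr01 s0); exists l => //.
have [k kE] := rational_gap Om m0 Lx Ll; have [j jE] := sqn_nat Om.
have : norm A (x - l) * sqn m < (1 + 1 / sqn m) * sqn m by rewrite ltr_pM2r.
rewrite mulrDl mul1r divfK ?gt_eqF // kE jE natr1 ltr_nat ltnS -(ler_nat R).
by rewrite -kE -jE -{2}[sqn m]mul1r ler_pM2r.
Qed.

Lemma deep_hole_gap x m : O m -> m != 0 -> Lam (rscale x m) ->
  (forall l, Lam l -> 1 <= norm A (x - l)) -> exists2 e : R, 0 < e &
  forall l, Lam l -> norm A (x - l) = 1 \/ 1 + e <= norm A (x - l).
Proof.
move=> Om m0 Lx far; have s0 : 0 < sqn m by rewrite sqn_gt0.
exists (1 / sqn m); first exact: divr_gt0.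
move=> l Ll; have := far l Ll; rewrite le_eqVlt => /orP[/eqP <-|gt1]; first by left.
right; have [k kE] := rational_gap Om m0 Lx Ll; have [j jE] := sqn_nat Om.
rewrite -(ler_pM2r s0) mulrDl !mul1r mulVf ?gt_eqF // kE jE natr1 ler_nat.
by rewrite -(ltr_nat R) -kE -jE -{1}[sqn m]mul1r ltr_pM2r.
Qed.

(** Two units congruent modulo 3 differ by 3 q with 9 |q|^2 <= 4, so q = 0. *)
Lemma finite_units : finite_set [set b : K | O b /\ sqn b = 1].
Proof.
have [F [finF FO FP]] := integers_mod R t (isT : (0 < 3)%N).
apply: (@finite_of_invariant _ _ _ F
  (fun (b : K) f => exists2 q, O q & b = f + q * 3)) => //.
  by move=> b [Ob _]; have [f [q [Ff Oq E]]] := FP b Ob; exists f => //; exists q.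
move=> b b' f [Ob b1] [Ob' b1'] [q Oq E] [q' Oq' E'].
have D : b - b' = of_real t 3 * (q - q').
  rewrite of_realC rmorph_nat E E' opprD addrACA subrr add0r mulrBl //.
have [i iE] := sqn_nat (integersB Oq Oq').
have H : sqn (b - b') <= 4.
  by have := sqn_parallelogram b b'; rewrite b1 b1'; lra.
rewrite D sqnM sqn_real iE in H.
have i0 : i = 0%N.
  case: i {iE} H => // i H; exfalso.
  have : (1 : R) <= i.+1%:R by rewrite ler1n.
  by rewrite expr2 in H; lra.
apply/eqP; rewrite -subr_eq0 D; apply/eqP.
have : q - q' = 0.
  by apply/eqP/negPn/negP; rewrite -sqn_gt0 iE i0 ltxx.
by move=> ->; rewrite mulr0.
Qed.

End Rigidity.

(** * Orbits of cusps *)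

Lemma double_sub (V : zmodType) (a b p : V) :
  (a + p + (a + p)) - (b + p + (b + p)) = (a - b) + (a - b).
Proof.
have E : (a + p) - (b + p) = a - b by rewrite opprD addrACA subrr addr0.
by rewrite opprD addrACA E.
Qed.

Section Finiteness.
Variables (R : realType) (t : ring_kind) (n : nat).
Local Notation K := (scalars R t).
Local Notation O := (@integers R t).
Local Notation Lam := (lattice_points R t n).
Variable A : 'M[K]_n.
Local Notation "<< x , y >>" := (pairing A x y).
Local Notation L := (orthogonal_sum A (II11 R t)).
Local Notation rho := (@rho R t n).
Hypothesis herm : forall x y, <<x, y>> = sconj <<y, x>>.
Hypothesis integral : forall x y, Lam x -> Lam y -> O <<x, y>>.
Hypothesis pos : Defs.positive_definite A.
Hypothesis cov : (covering_radius A <= 1)%E.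
Variable k : nat.
Hypothesis k0 : (0 < k)%N.
Hypothesis translations : forall l, Lam l ->
  exists2 g, Reflec L g & exists c, is_trans A g (rscale l k%:R) c.

Lemma add_self_inj (a b : K) : a + a = b + b -> a = b.
Proof.
have half (c : K) : of_real t 2^-1 * (c + c) = c.
  rewrite mulrDr -mulrDl -rmorphD (_ : 2^-1 + 2^-1 = 1); last by field.
  by rewrite rmorph1 mul1r.
by move=> ab; rewrite -(half a) ab half.
Qed.

Lemma central_trans z : O z -> realpart z = 0 ->
  exists2 g, Reflec L g & is_trans A g 0 (12 * z).
Proof. exact: central_imaginary. Qed.

(** A representative v of a cusp at which the descent has stopped at a nonzero
height m; x is the deep hole under the cusp. *)
Record deep_position (v : 'cV[K]_(n + 2)) (x : 'cV[K]_n) (y m : K) : Prop := {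
  dp_m0 : m != 0;
  dp_eq : v = rscale (vec x 1 y) m;
  dp_lattice : lattice_points R t (n + 2) v;
  dp_isotropic : Defs.isotropic L (vec x 1 y);
  dp_minimal : minimal A v }.

Lemma dp_integral v x y m : deep_position v x y m -> O m /\ Lam (rscale x m).
Proof.
by case=> m0 -> Lv _ _; move: Lv; rewrite vecZ mul1r => /lattice_vec[].
Qed.

Lemma dp_near v x y m : deep_position v x y m ->
  exists2 l, Lam l & norm A (x - l) = 1.
Proof.
move=> dp; have [Om Lx] := dp_integral dp.
have [l Ll l1] := near_point herm integral pos cov Om (dp_m0 dp) Lx.
exists l => //; have := dp_minimal dp; rewrite (dp_eq dp) => vmin.
by have [] := minimal_far herm integral pos (dp_m0 dp) vmin (dp_isotropic dp) Ll l1.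
Qed.

Lemma dp_far v x y m : deep_position v x y m ->
  forall l, Lam l -> 1 <= norm A (x - l).
Proof.
move=> dp l Ll; rewrite leNgt; apply/negP => lt1.
have := dp_minimal dp; rewrite (dp_eq dp) => vmin.
have [E _] := minimal_far herm integral pos (dp_m0 dp) vmin (dp_isotropic dp) Ll (ltW lt1).
by rewrite E ltxx in lt1.
Qed.

Lemma dp_phase v x y m l : deep_position v x y m -> Lam l ->
  norm A (x - l) = 1 -> O (y + <<l, x>> + (y + <<l, x>>)).
Proof.
move=> dp Ll l1; have := dp_minimal dp; rewrite (dp_eq dp) => vmin.
have l1' : norm A (x - l) <= 1 by rewrite l1.
by have [] := minimal_far herm integral pos (dp_m0 dp) vmin (dp_isotropic dp) Ll l1'.
Qed.

Lemma dp_trans v x y m g l c : deep_position v x y m -> Reflec L g ->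
  is_trans A g l c -> deep_position (g *m v) (x + l) (y - <<l, x>> + c) m.
Proof.
move=> [m0 vE Lv iso vmin] Wg gT; have gv : g *m vec x 1 y =
    vec (x + l) 1 (y - <<l, x>> + c) by rewrite gT rscale1 mulr1.
split=> //.
- by rewrite vE rscale_mul gv.
- exact: Aut_lattice (Reflec_Aut Wg) Lv.
- by rewrite -gv; apply: isotropic_Reflec.
move=> w Ww; have -> : ht (g *m v) = ht v.
  by rewrite vE rscale_mul gv !ht_scale !ht_vec.
by rewrite mulmxA; apply: vmin; apply: ReflecM.
Qed.

(** The lattice points around a deep hole x, seen from one of them. *)
Definition hole_shape (x l0 : 'cV[K]_n) : set 'cV[K]_n :=
  [set l | Lam l /\ norm A (x - l0 - l) = 1].

(** After translation by Reflec L the deep hole x is next to one of finitely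
many points i.1.1, and its surrounding lattice points form one of finitely many
sets i.1.2.  The residue i.2 records the phase of the cusp; the modulus 24 is
twice the exponent of the central translations, because the phase is only half
integral. *)
Definition cusp_invariant (g : 'M[K]_(n + 2))
    (i : 'cV[K]_n * set 'cV[K]_n * K) :=
  exists w x y m, [/\ Reflec L w, deep_position (w *m (g *m rho)) x y m,
    [/\ Lam i.1.1, norm A (x - i.1.1) = 1 & i.1.2 = hole_shape x i.1.1] &
    exists2 q, O q & y + <<i.1.1, x>> + (y + <<i.1.1, x>>) = i.2 + q * 24].

Lemma is_transE g l c : is_trans A g l c ->
  forall x a, g *m vec x 0 a = vec x 0 (a - <<l, x>>).
Proof. by move=> gT x a; rewrite gT rscale0 addr0 mulr0 addr0. Qed.

(** Equal invariants give the same x by rigidity, and values of y that differ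
by a central translation in Reflec L, hence the same isotropic line. *)
Lemma cusp_classes_deep : exists S : set 'M[K]_(n + 2),
  [/\ finite_set S, S `<=` Aut L & forall g, Aut L g ->
    (exists w x y m, Reflec L w /\ deep_position (w *m (g *m rho)) x y m) ->
    exists s w b, [/\ S s, Reflec L w & w *m (g *m rho) = rscale (s *m rho) b]].
Proof.
have [Fk [finFk FkL FkP]] := lattice_mod R t n k0.
have [F24 [finF24 F24O F24P]] := integers_mod R t (isT : (0 < 24)%N).
pose G : set 'M[K]_(n + 2) := [set g | Aut L g /\
  exists w x y m, Reflec L w /\ deep_position (w *m (g *m rho)) x y m].
have finI : finite_set (Fk `*` [set X | X `<=` [set l | Lam l /\ norm A l <= 4]] `*` F24).
  apply: finite_setX => //; apply: finite_setX => //.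
  exact/finite_subsets/finite_ball.
have [|S [finS SG GS]] := @finite_representatives _ _ G _ cusp_invariant finI.
  move=> g [Ag [w [x [y [m [Ww dp]]]]]].
  have [l Ll l1] := dp_near dp.
  have [l0 [l' [Fl0 Ll' lE]]] := FkP l Ll.
  have [T WT [c TT]] := translations (latticeN Ll').
  have := dp_trans dp WT TT; set x' := x + _; set y' := _ + c => dp'.
  have xl0 : norm A (x' - l0) = 1.
    by rewrite -l1 /x' lE rscaleNl opprD -addrA (addrC (- rscale _ _)).
  have [f [q [Ff Oq fE]]] := F24P _ (dp_phase dp' (FkL _ Fl0) xl0).
  exists (l0, hole_shape x' l0, f).
    split=> //; split=> // l2 [Ll2 E2]; split=> //.
    have -> : l2 = (x' - l0) - (x' - l0 - l2) by rewrite opprB addrC subrK.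
    by have := norm_parallelogram herm pos (x' - l0) (x' - l0 - l2);
      rewrite xl0 E2; lra.
  exists (T *m w), x', y', m; split=> //.
  - exact: ReflecM.
  - by rewrite -mulmxA.
  - by split=> //; apply: FkL.
  - by exists q.
exists S; split=> // [g /SG[]//|g Ag gdp].
have [s [[[l0 N] f] [Ss si gi]]] := GS g (conj Ag gdp).
move: si => [ws [x [y [m [Wws dp [/= Ll0 xl0 NE] [q Oq fE]]]]]].
move: gi => [wg [x' [y' [m' [Wwg dp' [/= _ xl0' NE'] [q' Oq' fE']]]]]].
have [Om Lx] := dp_integral dp.
have xx : x = x'.
  have [e e0 gap] := deep_hole_gap herm integral pos Om (dp_m0 dp) Lx (dp_far dp).
  apply: (deep_hole_rigid herm pos cov e0 gap) => l Ll l1.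
  have H (z : 'cV[K]_n) : z - l0 - (l - l0) = z - l by rewrite opprB addrA subrK.
  have : N (l - l0) by rewrite NE; split; [exact: latticeB|rewrite H].
  by rewrite NE' => -[_]; rewrite H.
subst x'.
have yy : y = y' + 12 * (q - q').
  have E : (y - y') + (y - y') = (q - q') * 24.
    have -> : (q - q') * 24 = (f + q * 24) - (f + q' * 24).
      by rewrite mulrBl opprD addrACA subrr add0r.
    by rewrite -fE -fE' double_sub.
  apply/eqP; rewrite addrC -subr_eq; apply/eqP; apply: add_self_inj.
  rewrite E -mulrDl -natrD -!(rmorph_nat (@of_real R t)).
  exact/esym/of_realC.
have re0 : realpart (q - q') = 0.
  have := isotropic_re (dp_isotropic dp'); have := isotropic_re (dp_isotropic dp).
  rewrite !sconj1 !mul1r yy raddfD /= -(rmorph_nat (@of_real R t)) re_realM; lra.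
have [T WT TT] := central_trans (integersB Oq Oq') re0.
have [v [Wv _ vws]] := ReflecV Wws.
exists s, (v *m (T *m wg)), (sinv m * m'); split=> //.
  by apply: ReflecM => //; apply: ReflecM.
have sE : s *m rho = rscale (v *m vec x 1 y) m.
  by rewrite -rscale_mul -(dp_eq dp) mulmxA vws mul1mx.
rewrite sE rscaleA (mulrA m) (mulsV (dp_m0 dp)) mul1r -!mulmxA.
rewrite (dp_eq dp') !rscale_mul TT (pairing0l herm) subr0 rscale1 addr0 mulr1.
by rewrite -yy.
Qed.

Lemma cusp_classes : exists S : set 'M[K]_(n + 2),
  [/\ finite_set S, S `<=` Aut L & forall g, Aut L g ->
    exists s w b, [/\ S s, Reflec L w & w *m (g *m rho) = rscale (s *m rho) b]].
Proof.
have [S [finS SA SP]] := cusp_classes_deep.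
have [A1 _ _] := Aut_subgroup L.
exists (1%:M |` S); split.
- by rewrite finite_setU; split => //; apply: finite_set1.
- by move=> s [->//|/SA].
move=> g Ag; have Lg := Aut_lattice Ag (@lattice_rho R t n).
have [w Ww wmin] := minimal_orbit A Lg.
have iso : Defs.isotropic L (w *m (g *m rho)).
  by apply: isotropic_Reflec => //; rewrite /isotropic norm_Aut //; apply: isotropic_rho.
have Lw := Aut_lattice (Reflec_Aut Ww) Lg.
have [x [m [a wE]]] := vec_surj (w *m (g *m rho)).
have [m0|m0] := eqVneq m 0.
  exists 1%:M, w, a; split=> //; first by left.
  move: iso; rewrite mul1mx rho_scale wE m0 => /(isotropic_ht0 pos) -> //.
have [|s [w' [b [Ss Ww' E]]]] := SP g Ag; last by exists s, w', b; split=> //; right.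
exists w, (rscale x (sinv m)), (a * sinv m), m; split=> //; split=> //.
- by rewrite wE; apply: normalize.
- by rewrite -(mulsV m0) -vecZ -wE; apply: isotropic_scale.
Qed.

Lemma vec_sum x m a : vec x m a = vec x 0 0 + rscale (vec 0 1 0) m + rscale rho a.
Proof.
by rewrite rho_scale vecZ mul1r mul0r /rscale mul0mx !vecD !addr0 !add0r.
Qed.

Definition cusp_stabilizer : set 'M[K]_(n + 2) :=
  [set s | Aut L s /\ exists b, s *m rho = rscale rho b].

Lemma stabilizer_unit s b : Aut L s -> s *m rho = rscale rho b ->
  O b /\ sqn b = 1.
Proof.
move=> As sE.
have Ob : O b.
  by have := Aut_lattice As (@lattice_rho R t n); rewrite sE rho_scale => /lattice_vec[].
have [s' [As' ss' s's]] := AutV As.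
have [x [m [a s'E]]] := vec_surj (s' *m rho).
have : rscale (s' *m rho) b = rho by rewrite -rscale_mul -sE mulmxA s's mul1mx.
rewrite s'E vecZ => /vec_inj[_ _ ab].
have := Aut_lattice As' (@lattice_rho R t n).
rewrite s'E => /lattice_vec[_ _ Oa].
have [_ a1] := integers_unit Oa Ob ab.
split=> //; have := sqnM a b; rewrite ab sqn1 a1 mul1r => <- //.
Qed.

(** As s preserves the pairing with rho up to the unit b, it preserves the
subspace of height 0, so it is block triangular; the block on Lambda is
ulsubmx s. *)
Lemma stabilizer_shape s b : Aut L s -> s *m rho = rscale rho b ->
  exists l c, s *m vec 0 1 0 = vec l b c /\
  forall x, exists a, s *m vec x 0 0 = vec (ulsubmx s *m x) 0 a.
Proof.
move=> As sE; have [Ob b1] := stabilizer_unit As sE; have [_ _ si] := As.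
have bb : b * sconj b = 1 by rewrite mul_conjC b1 rmorph1.
have htE v : ht (s *m v) = b * ht v.
  have [x [m [a ->]]] := vec_surj v; have := si rho (vec x m a).
  have [x' [m' [a' ->]]] := vec_surj (s *m vec x m a).
  rewrite sE rho_scale !pairing_vec !(pairing0l herm) !ht_vec raddf0 !mul0r !add0r.
  by rewrite sconj1 mul1r => <-; rewrite mulrA bb mul1r.
have [l [h [c E]]] := vec_surj (s *m vec 0 1 0).
exists l, c; split.
  by rewrite E; have := htE (vec 0 1 0); rewrite E !ht_vec mulr1 => ->.
move=> x; have [x' [h' [a E']]] := vec_surj (s *m vec x 0 0); exists a.
have := htE (vec x 0 0); rewrite E' !ht_vec mulr0 => ->; congr vec.
have := congr1 (@usubmx _ n 2 1) E'; rewrite /vec col_mxKu => <-.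
rewrite -{1}[s]submxK mul_block_col col_mxKu.
have -> : \col_(i < 2) (if i == 0 then 0 else 0) = 0 :> 'cV[K]_2.
  by apply/matrixP => i j; rewrite !mxE; case: ifP.
by rewrite mulmx0 addr0.
Qed.

End Finiteness.

(** * The stabilizer of a cusp *)

Section Stabilizer.
Variables (R : realType) (t : ring_kind) (n : nat).
Local Notation K := (scalars R t).
Local Notation O := (@integers R t).
Local Notation Lam := (lattice_points R t n).
Variable A : 'M[K]_n.
Local Notation "<< x , y >>" := (pairing A x y).
Local Notation L := (orthogonal_sum A (II11 R t)).
Local Notation rho := (@rho R t n).
Hypothesis herm : forall x y, <<x, y>> = sconj <<y, x>>.
Hypothesis integral : forall x y, Lam x -> Lam y -> O <<x, y>>.
Hypothesis pos : Defs.positive_definite A.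
Variable k : nat.
Hypothesis k0 : (0 < k)%N.
Hypothesis translations : forall l, Lam l ->
  exists2 g, Reflec L g & exists c, is_trans A g (rscale l k%:R) c.

(** The linear part Phi on Lambda, the unit b by which rho is scaled, and, once
the translation part is reduced by Reflec L, what is left of it: a
Lambda-component l and a residue f of the central component. *)
Definition stabilizer_invariant (s : 'M[K]_(n + 2))
    (i : 'M[K]_n * K * 'cV[K]_n * K) :=
  let: (Phi, b, l, f) := i in
  exists2 w, Reflec L w & exists c,
  [/\ w *m s *m rho = rscale rho b, w *m s *m vec 0 1 0 = vec l b c,
      forall x, exists a, w *m s *m vec x 0 0 = vec (Phi *m x) 0 a &
      exists2 q, O q & c = f + q * 12].

(** The linear part maps basis vectors to lattice vectors of the same norm, so
it takes finitely many values.  If two elements have the same invariants, they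
differ by a central translation in Reflec L: the height-0 entries left out of
the invariants are determined by orthogonality to the image of
(0; 1, 0). *)
Lemma stabilizer_classes : exists S : set 'M[K]_(n + 2),
  [/\ finite_set S, S `<=` cusp_stabilizer A & forall s, cusp_stabilizer A s ->
    exists2 s', S s' & exists2 w, Reflec L w & s = w *m s'].
Proof.
have [Fk [finFk FkL FkP]] := lattice_mod R t n k0.
have [F12 [finF12 F12O F12P]] := integers_mod R t (isT : (0 < 12)%N).
pose E i j : set K := (fun v : 'cV[K]_n => v i 0) @`
  [set v | Lam v /\ norm A v <= norm A (std R t j)].
have finPhi : finite_set [set Phi : 'M[K]_n | forall i j, E i j (Phi i j)].
  by apply: (@finite_matrices K n n E) => i j; apply/finite_image/finite_ball.
have finI : finite_set ([set Phi : 'M[K]_n | forall i j, E i j (Phi i j)] `*`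
    [set b : K | O b /\ sqn b = 1] `*` Fk `*` F12).
  by do 3![apply: finite_setX => //]; apply: finite_units.
have [|S [finS SG GS]] := @finite_representatives _ _ (cusp_stabilizer A) _
    stabilizer_invariant finI.
  move=> s [As [b sE]].
  have [Ob b1] := stabilizer_unit As sE.
  have bb : sconj b * b = 1 by rewrite mul_conj b1 rmorph1.
  have [l [c [s1E s0E]]] := stabilizer_shape herm As sE.
  have [O0 O1] := (integers0 R t, integers1 R t).
  have Ls v : lattice_points R t (n + 2) v -> lattice_points R t (n + 2) (s *m v).
    by move=> Lv; apply: Aut_lattice As Lv.
  have /lattice_vec[Ll _ _] : lattice_points R t (n + 2) (vec l b c).
    by rewrite -s1E; apply/Ls/lattice_vec; split=> //; apply: lattice0.
  have [l0 [l' [Fl0 Ll' lE]]] := FkP l Ll.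
  (* The image of (0; 1, 0) has height b, so the translation by - l' (conj b) k
     moves its Lambda-component by - l' k. *)
  have Lm : Lam (rscale (- l') (sconj b)).
    by apply: latticeZ; [apply: latticeN|apply: integers_conj].
  have [T WT [d TT]] := translations Lm.
  have lT : l + rscale (rscale (rscale (- l') (sconj b)) k%:R) b = l0.
    rewrite !rscaleA -(rmorph_nat (@of_real R t)) of_realC mulrA bb mul1r.
    by rewrite rmorph_nat rscaleNl lE addrK.
  have Ts1 : T *m s *m vec 0 1 0 =
      vec l0 b (c - <<rscale (rscale (- l') (sconj b)) k%:R, l>> + d * b).
    by rewrite -mulmxA s1E TT lT.
  set c' := _ + d * b in Ts1.
  have Oc' : O c'.
    have : lattice_points R t (n + 2) (vec l0 b c').
      rewrite -Ts1 -mulmxA; apply: Aut_lattice (Reflec_Aut WT) _.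
      by apply/Ls/lattice_vec; split=> //; apply: lattice0.
    by move=> /lattice_vec[].
  have [f [q [Ff Oq cE]]] := F12P _ Oc'.
  exists (ulsubmx s, b, l0, f).
    split=> //; split=> //; split=> // i j.
    have [a aE] := s0E (std R t j).
    exists (ulsubmx s *m std R t j); last by rewrite mul_std.
    split.
      have : lattice_points R t (n + 2) (vec (ulsubmx s *m std R t j) 0 a).
        by rewrite -aE; apply/Ls/lattice_vec; split=> //; apply: lattice_std.
      by move=> /lattice_vec[].
    have := norm_Aut (vec (std R t j) 0 0) As; rewrite aE !norm_vec raddf0 !mul0r.
    by rewrite raddf0 mulr0 !addr0 => ->.
  exists T => //; exists c'; split=> //; last by exists q.
    rewrite -mulmxA sE rscale_mul /rho (is_transE TT) (pairing0r A) subr0 //.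
  move=> x; have [a aE] := s0E x.
  by rewrite -mulmxA aE (is_transE TT); eexists.
exists S; split=> // s Gs.
have [s' [[[[Phi b] l] f] [Ss' si' si]]] := GS s Gs.
exists s' => //.
have [As [b0 sE0]] := Gs; have [As' _] := SG _ Ss'.
move: si => [w Ww [c [wr w1 w0 [q Oq cE]]]].
move: si' => [w' Ww' [c' [wr' w1' w0' [q' Oq' cE']]]].
have Aws : Aut L (w *m s) by apply: AutM => //; apply: Reflec_Aut.
have Aws' : Aut L (w' *m s') by apply: AutM => //; apply: Reflec_Aut.
have [Ob b1] := stabilizer_unit Aws wr.
have bb : sconj b * b = 1 by rewrite mul_conj b1 rmorph1.
pose z := (q - q') * sconj b.
have Oz : O z by apply: integersM; [apply: integersB|apply: integers_conj].
have cc : c = c' + 12 * z * b.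
  rewrite /z -!mulrA bb mulr1 cE cE' -(rmorph_nat (@of_real R t)) of_realC.
  by rewrite mulrBl !addrA [RHS](ACl (1*3*(2*4))%AC) /= subrr addr0.
have bb' : b * sconj b = 1 by rewrite mul_conjC b1 rmorph1.
have rz : realpart z = 0.
  have iso d (g : 'M[K]_(n + 2)) : Aut L g -> g *m vec 0 1 0 = vec l b d ->
      norm A l + 2 * realpart (sconj b * d) = 0.
    move=> Ag gE; rewrite -norm_vec -gE norm_Aut // norm_vec (norm0 A).
    by rewrite mulr0 raddf0 mulr0 addr0.
  have := iso _ _ Aws w1; have := iso _ _ Aws' w1'.
  rewrite cc mulrDr raddfD /= (re_mulC _ (12 * z * b)) -mulrA bb' mulr1.
  rewrite -(rmorph_nat (@of_real R t)) re_realM; lra.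
have [T WT TT] := central_imaginary herm integral Oz rz.
have T0 x a : T *m vec x 0 a = vec x 0 a.
  by rewrite (is_transE TT) (pairing0l herm) subr0.
have key : w *m s = T *m (w' *m s').
  apply: mul_mx_ext => v; have [x [m [a ->]]] := vec_surj v.
  rewrite vec_sum -!mulmxA !mulmxDr !rscale_mul.
  congr (_ + rscale _ m + rscale _ a).
  - have [a0 E0] := w0 x; have [a1 E1] := w0' x.
    rewrite mulmxA E0 (mulmxA w') E1 T0; congr vec.
    have pair d e (g : 'M[K]_(n + 2)) : Aut L g -> g *m vec 0 1 0 = vec l b d ->
        g *m vec x 0 0 = vec (Phi *m x) 0 e -> e = - (b * <<l, Phi *m x>>).
      move=> [_ _ gi] g1 g0; have := gi (vec 0 1 0) (vec x 0 0).
      rewrite g1 g0 !pairing_vec (pairing0l herm) !mulr0 !addr0 => /eqP.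
      rewrite addrC addr_eq0 => /eqP be.
      by rewrite -mulrN -be mulrA bb' mul1r.
    by rewrite (pair _ _ _ Aws w1 E0) (pair _ _ _ Aws' w1' E1).
  - rewrite mulmxA w1 (mulmxA w') w1' TT (pairing0l herm) subr0 /rscale mul0mx addr0.
    by rewrite -cc.
  - by rewrite mulmxA wr (mulmxA w') wr' rho_scale T0.
have [v [Wv _ vw]] := ReflecV Ww.
exists (v *m (T *m w')); first by apply: ReflecM => //; apply: ReflecM.
by rewrite -!mulmxA -key mulmxA vw mul1mx.
Qed.

End Stabilizer.

(** * Finite index *)

Section Reflective.
Variables (R : realType) (t : ring_kind) (n : nat).
Local Notation K := (scalars R t).
Local Notation O := (@integers R t).
Local Notation Lam := (lattice_points R t n).
Variable A : 'M[K]_n.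
Local Notation "<< x , y >>" := (pairing A x y).
Local Notation L := (orthogonal_sum A (II11 R t)).
Local Notation rho := (@rho R t n).

Lemma Reflec_conj m (B : 'M[K]_m) h w : Aut B h -> Reflec B w ->
  exists2 w', Reflec B w' & w *m h = h *m w'.
Proof.
move=> Ah Ww; have [h' [Ah' hh' h'h]] := AutV Ah.
exists (h' *m w *m h); first exact: Reflec_normal.
by rewrite !mulmxA hh' mul1mx.
Qed.

Lemma reflective_of_classes m (B : 'M[K]_m) (S : set 'M[K]_m) : finite_set S ->
  (forall g, Aut B g -> exists2 s, S s & exists2 w, Reflec B w & g = s *m w) ->
  reflective B.
Proof.
move=> finS SP; rewrite /reflective /Defs.finite_index.
apply: sub_finite_set (finite_image (fun s => [set s *m h | h in Reflec B]) finS).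
move=> _ [g Ag <-]; have [s Ss [w Ww ->]] := SP g Ag; exists s => //.
have [w' [Ww' ww' w'w]] := ReflecV Ww.
apply/seteqP; split=> _ [h Wh <-].
  exists (w' *m h); first exact: ReflecM.
  by rewrite -mulmxA (mulmxA w) ww' mul1mx.
by exists (w *m h); [exact: ReflecM|rewrite mulmxA].
Qed.

(** Every g is of the form w' s w2 s2, with w' and w2 in Reflec L and with s and
s2 in finite sets of representatives of cusps and of the stabilizer of rho.
Normality collects the two reflection factors on the right. *)
Lemma reflective_sum : 
  (forall x y, <<x, y>> = sconj <<y, x>>) ->
  (forall x y, Lam x -> Lam y -> O <<x, y>>) ->
  Defs.positive_definite A -> (covering_radius A <= 1)%E ->
  Defs.finite_index +%R Lam (root_span A) -> reflective L.
Proof.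
move=> herm integral pos cov fin.
have [k k0 translations] := lattice_translations herm integral fin.
have [S1 [fin1 S1A S1P]] := cusp_classes herm integral pos cov k0 translations.
have [S2 [fin2 S2A S2P]] := stabilizer_classes herm integral pos k0 translations.
apply: (@reflective_of_classes _ _ ((fun p => p.1 *m p.2) @` (S1 `*` S2))).
  by apply/finite_image/finite_setX.
move=> g Ag; have [s [w [b [Ss Ww E]]]] := S1P g Ag.
have As := S1A _ Ss; have [s' [As' ss' s's]] := AutV As.
have Stab : cusp_stabilizer A (s' *m (w *m g)).
  split; first by apply: AutM => //; apply: AutM => //; apply: Reflec_Aut.
  by exists b; rewrite -!mulmxA E rscale_mul mulmxA s's mul1mx.
have [s2 Ss2 [w2 Ww2 E2]] := S2P _ Stab.
have [As2 _] := S2A _ Ss2.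
have [w' [Ww' ww' w'w]] := ReflecV Ww.
have gE : g = w' *m (s *m (w2 *m s2)).
  by rewrite -E2 (mulmxA s) ss' mul1mx mulmxA w'w mul1mx.
have [w3 Ww3 E3] := Reflec_conj As2 Ww2.
have [w4 Ww4 E4] := Reflec_conj (AutM As As2) Ww'.
exists (s *m s2); first by exists (s, s2).
exists (w4 *m w3); first exact: ReflecM.
by rewrite gE E3 (mulmxA s) (mulmxA w') E4 -mulmxA.
Qed.

End Reflective.

Theorem theorem6p1 (R : realType) (t : ring_kind) (n : nat)
    (A : 'M[scalars R t]_n)
    (latticeA : is_lattice A)
    (posA : positive_definite A)
    (rootsA : finite_index +%R (lattice_points R t n) (root_span A))
    (coverA : (covering_radius A <= 1)%E) :
  let L := orthogonal_sum A (II11 R t) in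
  reflective L /\
  ((covering_radius A < 1)%E ->
   forall v w : 'cV[scalars R t]_(n + 2),
     primitive v -> isotropic L v -> primitive w -> isotropic L w ->
     exists g a, [/\ Reflec L g, is_unit a & g *m v = rscale w a]).
Proof.
move=> L; case: latticeA => herm integral _.
split; first exact: reflective_sum.
move=> cov v w; exact: transitive_isotropic.
Qed.
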